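(* Let the sign $\pm$ be fixed (upper signs for $S=S^+_4$, lower signs for $S=S^-_4$), and for $k\in\mathbb{N}_0$ let $\{f^{k,\pm}_0,\ldots,f^{k,\pm}_{2k+1}\}$ be the Gelfand–Tsetlin basis of $\mathcal{M}_k(\mathbb{R}^3,S^{\pm}_4)$ given by $$f^{k,\pm}_{2j}=e^{x_3e_3\underline{\partial}}\left(\frac{z^j\,\overline{z}^{\,k-j}}{j!(k-j)!}\,v^+\right),\qquad f^{k,\pm}_{2j+1}=e^{x_3e_3\underline{\partial}}\left(\frac{z^j\,\overline{z}^{\,k-j}}{j!(k-j)!}\,v^-\right),\qquad j=0,\ldots,k.$$ (a) For each $k\in\mathbb{N}_0$ and $j=0,\ldots,k$, $$f^{k,\pm}_{2j}=(p^k_j,\mp q^k_j)\quad\text{and}\quad f^{k,\pm}_{2j+1}=(\pm q^k_{j+1},\,p^k_j),$$ where $$p^k_j(z,\overline{z},x_3)=\sum_{s=0}^{\min(j,k-j)}(-1)^s\frac{(2x_3)^{2s}\,z^{j-s}\,\overline{z}^{\,k-j-s}}{(2s)!(j-s)!(k-j-s)!},$$ $$q^k_j(z,\overline{z},x_3)=\sum_{s=0}^{\min(j-1,k-j)}(-1)^s\frac{(2x_3)^{2s+1}\,z^{j-1-s}\,\overline{z}^{\,k-j-s}}{(2s+1)!(j-1-s)!(k-j-s)!},$$ with $q^k_0=0=q^k_{k+1}$. (b) For each $k\in\mathbb{N}$, $$\frac{\partial f^{k,\pm}_j}{\partial x_3}=\begin{cases}\mp(-1)^j\,2\,f^{k-1,\pm}_{j-1},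 & j=1,\ldots,2k,\\ 0,& j=0,\,2k+1;\end{cases}$$ $$\frac{\partial f^{k,\pm}_j}{\partial z}=\begin{cases}f^{k-1,\pm}_{j-2}, & j=2,\ldots,2k+1,\\ 0,& j=0,1;\end{cases}\qquad \frac{\partial f^{k,\pm}_j}{\partial\overline{z}}=\begin{cases}f^{k-1,\pm}_{j}, & j=0,\ldots,2k-1,\\ 0,& j=2k,\,2k+1.\end{cases}$$ (c) For $k\in\mathbb{N}_0$ and $j=0,\ldots,2k+1$, $$f^{k,\pm}_{2k+1-j}=(-1)^j\,(f^{k,\pm}_j)^*,$$ where $s^*=(-\overline{s_2},\overline{s_1})$ for each $s=(s_1,s_2)\in S$.
   Context: $\mathbb{C}_4$ is the complex Clifford algebra generated by $e_1,\dots,e_4$ with $e_j^2=-1$, $e_ie_j=-e_je_i$ ($i\ne j$). For $j=1,2$ put $w_j=\frac12(e_{2j-1}+ie_{2j})$, $\overline{w}_j=\frac12(-e_{2j-1}+ie_{2j})$, $I_j=\overline{w}_jw_j$, and $I=I_1I_2$. Let $W=\mathrm{span}_{\mathbb{C}}\{w_1,w_2\}$, $S^+_4=\Lambda^+(W)I=\mathrm{span}_{\mathbb{C}}\{I,w_1w_2I\}$ and $S^-_4=\Lambda^-(W)I=\mathrm{span}_{\mathbb{C}}\{w_1I,w_2I\}$, viewed as basic spinor representations of $Spin(3)\subset Spin(4)$ under left multiplication. For $S=S_4^+$ put $v^+=I$, $v^-=w_1w_2I$; for $S=S_4^-$ put $v^+=w_2I$, $v^-=w_1I$. In either case $s=s_1v^++s_2v^-$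 ($s_1,s_2\in\mathbb{C}$) is written $s=(s_1,s_2)$, identifying $S$ with $\mathbb{C}^2$; $S$-valued functions are written in components accordingly. $x=(x_1,x_2,x_3)\in\mathbb{R}^3$, $z=x_1+ix_2$, $\overline{z}=x_1-ix_2$, $\frac{\partial}{\partial z}=\frac12(\frac{\partial}{\partial x_1}-i\frac{\partial}{\partial x_2})$, $\frac{\partial}{\partial\overline{z}}=\frac12(\frac{\partial}{\partial x_1}+i\frac{\partial}{\partial x_2})$, $\underline{\partial}=e_1\frac{\partial}{\partial x_1}+e_2\frac{\partial}{\partial x_2}$, $\partial=\underline{\partial}+e_3\frac{\partial}{\partial x_3}$. For a polynomial $p$ in $(x_1,x_2)$ of degree $k$, $e^{x_3e_3\underline{\partial}}p=\sum_{s=0}^k\frac{x_3^s}{s!}(e_3\underline{\partial})^sp$. $\mathcal{M}_k(\mathbb{R}^3,S)$ is the space of $S$-valued $k$-homogeneous polynomials $P$ on $\mathbb{R}^3$ with $\partial P=0$. The Gelfand–Tsetlin basis is with respect to the chain $\mathfrak{so}(3)\supset\mathfrak{so}(2)=\mathrm{span}\{e_1e_2\}$, i.e. a basis consisting of one non-zero vector from each one-dimensional summand of the multiplicity-free decomposition into irreducible $\mathfrak{so}(2)$-modules. *)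

(* Defs.v *)
From HB Require Import structures.
From mathcomp Require Import all_boot all_order all_algebra.
From mathcomp Require Import reals.
From mathcomp Require Import complex.
From mathcomp Require Import mpoly.

Set Implicit Arguments.
Unset Strict Implicit.
Unset Printing Implicit Defensive.

Import Order.TTheory GRing.Theory Num.Theory.
Local Open Scope ring_scope.

Section SymDiff.
Variable T : finType.
Implicit Types A B C : {set T}.

Definition symdiff A B : {set T} := (A :\: B) :|: (B :\: A).

Lemma in_symdiff A B x : (x \in symdiff A B) = (x \in A) (+) (x \in B).
Proof. by rewrite !inE; case: (x \in A); case: (x \in B). Qed.

Lemma symdiffC A B : symdiff A B = symdiff B A.
Proof. by apply/setP => x; rewrite !in_symdiff addbC. Qed.

Lemma symdiffA A B C : symdiff A (symdiff B C) = symdiff (symdiff A B) C.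
Proof. by apply/setP => x; rewrite !in_symdiff addbA. Qed.

Lemma symdiff0s A : symdiff set0 A = A.
Proof. by apply/setP => x; rewrite !in_symdiff inE. Qed.

Lemma symdiffs0 A : symdiff A set0 = A.
Proof. by rewrite symdiffC symdiff0s. Qed.

Lemma symdiffss A : symdiff A A = set0.
Proof. by apply/setP => x; rewrite !in_symdiff inE addbb. Qed.

Lemma symdiffK A : involutive (symdiff A).
Proof. by move=> B; rewrite symdiffA symdiffss symdiff0s. Qed.

End SymDiff.

(* The Clifford algebra over K with generators e_0, ..., e_(n-1), where
   e_j ^ 2 = -1 and e_i e_j = - e_j e_i for i != j, realised on its basis
   e_A = e_(a_1) ... e_(a_h), A = {a_1 < ... < a_h}: x is stored as the
   family of its coefficients x A. *)
Definition clifford (n : nat) (K : fieldType) := {ffun {set 'I_n} -> K^o}.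

Section Clifford.
Variables (n : nat) (K : fieldType).
Local Notation Cl := (clifford n K).
Implicit Types (A B C : {set 'I_n}) (x y z : Cl).

HB.instance Definition _ := Vector.copy Cl {ffun {set 'I_n} -> K^o}.

(* e_A e_B = cl_sign A B * e_(symdiff A B): one factor -1 for each pair
   a \in A, b \in B with b < a (reordering) and for each a = b
   (as e_a ^ 2 = -1). *)
Definition cl_sign A B : K :=
  (-1) ^+ (\sum_(a in A) \sum_(b in B) (b <= a))%N.

Definition cl_one : Cl := [ffun A => (A == set0)%:R].

Definition cl_mul x y : Cl :=
  [ffun C => \sum_A cl_sign A (symdiff A C) * x A * y (symdiff A C)].

Lemma prod_symdiff (u : 'I_n -> K) A B : (forall a, u a * u a = 1) ->
  \prod_(a in symdiff A B) u a = \prod_(a in A) u a * \prod_(a in B) u a.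
Proof.
move=> u2; rewrite big_mkcond [in RHS]big_mkcond [X in _ * X]big_mkcond /=.
rewrite -big_split /=; apply: eq_bigr => a _; rewrite in_symdiff.
by case: (a \in A); case: (a \in B); rewrite /= ?u2 ?mulr1 ?mul1r.
Qed.

Lemma cl_signE A B :
  cl_sign A B = \prod_(a in A) \prod_(b in B) (-1) ^+ (b <= a)%N.
Proof.
rewrite /cl_sign expr_sum; apply: eq_bigr => a _.
by rewrite expr_sum.
Qed.

Lemma cl_sign_mull A B C :
  cl_sign (symdiff A B) C = cl_sign A C * cl_sign B C.
Proof.
rewrite !cl_signE prod_symdiff // => a; rewrite -big_split /=.
by rewrite big1 // => b _; rewrite -expr2 sqrr_sign.
Qed.

Lemma cl_sign_mulr A B C :
  cl_sign A (symdiff B C) = cl_sign A B * cl_sign A C.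
Proof.
rewrite !cl_signE -big_split /=; apply: eq_bigr => a _.
by rewrite prod_symdiff // => b; rewrite -expr2 sqrr_sign.
Qed.

Lemma cl_sign_sqr A B : cl_sign A B * cl_sign A B = 1.
Proof. by rewrite -expr2 sqrr_sign. Qed.

Lemma cl_sign0s A : cl_sign set0 A = 1.
Proof. by rewrite cl_signE big_set0. Qed.

Lemma cl_signs0 A : cl_sign A set0 = 1.
Proof. by rewrite cl_signE big1 // => a _; rewrite big_set0. Qed.

Lemma cl_mulA : associative cl_mul.
Proof.
move=> x y z; apply/ffunP => D; rewrite !ffunE.
under eq_bigr => A _ do rewrite ffunE mulr_sumr.
under [RHS]eq_bigr => C _ do rewrite ffunE mulr_sumr mulr_suml.
rewrite [RHS]exchange_big /=; apply: eq_bigr => A _.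
rewrite [RHS](reindex_inj (can_inj (symdiffK A))) /=.
apply: eq_bigr => B _; rewrite symdiffK.
have -> : symdiff (symdiff A B) D = symdiff B (symdiff A D).
  by rewrite symdiffA [symdiff B A]symdiffC.
set E := symdiff B _.
have -> : cl_sign (symdiff A B) E * (cl_sign A B * x A * y B) * z E =
  (cl_sign (symdiff A B) E * cl_sign A B) * (x A * (y B * z E)).
  by rewrite !mulrA.
have -> : cl_sign (symdiff A B) E * cl_sign A B =
  cl_sign A (symdiff A D) * cl_sign B E.
  rewrite cl_sign_mull {1}/E cl_sign_mulr.
  rewrite mulrC !mulrA cl_sign_sqr mul1r //.
by rewrite -!mulrA; congr (_ * _); rewrite !mulrA [x A * _]mulrC.
Qed.

Lemma cl_mul1l : left_id cl_one cl_mul.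
Proof.
move=> x; apply/ffunP => C; rewrite ffunE (bigD1 set0) //= big1 => [|A A0].
  by rewrite ffunE eqxx cl_sign0s symdiff0s !mul1r addr0.
by rewrite ffunE (negPf A0) mulr0 mul0r.
Qed.

Lemma cl_mul1r : right_id cl_one cl_mul.
Proof.
move=> x; apply/ffunP => C; rewrite ffunE (bigD1 C) //= big1 => [|A AC].
  by rewrite symdiffss ffunE eqxx cl_signs0 mul1r mulr1 addr0.
rewrite ffunE; case: eqP => [AC0|_]; last by rewrite mulr0.
by case/eqP: AC; rewrite -[A]symdiffs0 -AC0 symdiffK.
Qed.

Lemma cl_mulDl : left_distributive cl_mul +%R.
Proof.
move=> x y z; apply/ffunP => C; rewrite !ffunE -big_split /=.
by apply: eq_bigr => A _; rewrite ffunE mulrDr mulrDl.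
Qed.

Lemma cl_mulDr : right_distributive cl_mul +%R.
Proof.
move=> x y z; apply/ffunP => C; rewrite !ffunE -big_split /=.
by apply: eq_bigr => A _; rewrite ffunE mulrDr.
Qed.

Lemma cl_one_neq0 : cl_one != 0.
Proof.
by apply/eqP => /ffunP/(_ set0)/eqP; rewrite !ffunE eqxx oner_eq0.
Qed.

HB.instance Definition _ := GRing.Zmodule_isNzRing.Build Cl
  cl_mulA cl_mul1l cl_mul1r cl_mulDl cl_mulDr cl_one_neq0.

Lemma cl_scaleAl (a : K) x y : a *: (x * y) = (a *: x) * y.
Proof.
apply/ffunP => C; rewrite !ffunE scaler_sumr; apply: eq_bigr => A _.
by rewrite !ffunE /GRing.scale /= !mulrA [a * _]mulrC.
Qed.

HB.instance Definition _ := GRing.Lmodule_isLalgebra.Build K Cl cl_scaleAl.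

Lemma cl_scaleAr (a : K) x y : a *: (x * y) = x * (a *: y).
Proof.
apply/ffunP => C; rewrite !ffunE scaler_sumr; apply: eq_bigr => A _.
by rewrite !ffunE /GRing.scale /= mulrCA.
Qed.

HB.instance Definition _ := GRing.Lalgebra_isAlgebra.Build K Cl cl_scaleAr.

Definition cl_basis A : Cl := [ffun B => (B == A)%:R].

Definition cl_gen (j : 'I_n) : Cl := cl_basis [set j].

Lemma cl_basisM A B :
  cl_basis A * cl_basis B = cl_sign A B *: cl_basis (symdiff A B).
Proof.
apply/ffunP => C; rewrite !ffunE (bigD1 A) //= big1 => [|D DA].
  rewrite !ffunE eqxx mulr1 addr0 /GRing.scale /=.
  have -> : (symdiff A C == B) = (C == symdiff A B).
    by apply/eqP/eqP => [<-|->]; rewrite symdiffK.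
  by case: eqP => [->|]; rewrite ?symdiffK ?mulr0.
by rewrite !ffunE (negPf DA) mulr0 mul0r.
Qed.

Lemma cl_sign1 i j : cl_sign [set i] [set j] = (-1) ^+ (j <= i)%N.
Proof. by rewrite /cl_sign !big_set1. Qed.

Lemma cl_basis0 : cl_basis set0 = 1.
Proof. by []. Qed.

Lemma cl_gen_sqr j : cl_gen j * cl_gen j = -1.
Proof.
by rewrite cl_basisM cl_sign1 leqnn symdiffss cl_basis0 scaleN1r.
Qed.

Lemma cl_gen_anticomm i j : i != j ->
  cl_gen i * cl_gen j = - (cl_gen j * cl_gen i).
Proof.
move=> ij; rewrite !cl_basisM !cl_sign1 symdiffC -scaleNr.
congr (_ *: _); case: (ltngtP i j) => [_|_|/val_inj/eqP]; last first.
- by rewrite (negPf ij).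
- by rewrite expr1 expr0.
- by rewrite expr1 expr0 opprK.
Qed.

Lemma cl_expand x : x = \sum_A x A *: cl_basis A.
Proof.
apply/ffunP => B; rewrite sum_ffunE (bigD1 B) //= big1 => [|A AB].
  by rewrite !ffunE eqxx addr0 /GRing.scale /= mulr1.
by rewrite !ffunE eq_sym (negPf AB) scaler0.
Qed.

(* The generators generate: adjoining a largest index multiplies on the
   right by the corresponding generator. *)
Lemma cl_basis_rcons A (j : 'I_n) : (forall a, a \in A -> (a < j)%N) ->
  cl_basis (j |: A) = cl_basis A * cl_gen j.
Proof.
move=> Aj; rewrite cl_basisM /cl_sign big1 => [|a aA]; last first.
  by rewrite big_set1 leqNgt Aj.
rewrite expr0 scale1r; congr cl_basis; apply/setP => x.
rewrite in_symdiff !inE; case: eqP => [->|_]; last by rewrite addbF.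
by rewrite addbT; case: (boolP (j \in A)) => // /Aj; rewrite ltnn.
Qed.

End Clifford.

(* Polynomials in x_1, x_2, x_3 with coefficients in the Clifford algebra C_4;
   the indices of generators and of variables are shifted by one. *)
Notation Cl4 R := (clifford 4 R[i]).
Notation clpoly R := {mpoly (clifford 4 R[i])[3]}.
Notation scpoly R := {mpoly R[i][3]}.

Variant spin_sign := Splus | Sminus.

Section Spinors.
Variable R : realType.
Local Notation C := R[i].
Local Notation Cl := (Cl4 R).
Implicit Types (S : spin_sign) (P : clpoly R) (g : scpoly R).

Definition pm S : C := if S is Splus then 1 else -1.

Definition e1 : Cl := cl_gen C (0 : 'I_4).
Definition e2 : Cl := cl_gen C (1 : 'I_4).
Definition e3 : Cl := cl_gen C (2 : 'I_4).
Definition e4 : Cl := cl_gen C (3 : 'I_4).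

Definition w1 : Cl := 2^-1 *: (e1 + 'i *: e2).
Definition w2 : Cl := 2^-1 *: (e3 + 'i *: e4).
Definition wbar1 : Cl := 2^-1 *: (- e1 + 'i *: e2).
Definition wbar2 : Cl := 2^-1 *: (- e3 + 'i *: e4).
Definition idem : Cl := (wbar1 * w1) * (wbar2 * w2).

Definition vplus S : Cl := if S is Splus then idem else w2 * idem.
Definition vminus S : Cl := if S is Splus then w1 * w2 * idem else w1 * idem.

Definition spinor_basis S : 2.-tuple Cl := [tuple vplus S; vminus S].
Definition spinor_space S : {vspace Cl} := <<spinor_basis S>>%VS.

(* The spinor g1 v^+ + g2 v^-, written (g1, g2), for complex polynomials g1
   and g2; in_alg embeds the scalars in the Clifford algebra. *)
Definition cl_embed (v : Cl) g : clpoly R := v *: map_mpoly (in_alg Cl) g.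
Definition spinor S (g1 g2 : scpoly R) : clpoly R :=
  cl_embed (vplus S) g1 + cl_embed (vminus S) g2.

(* s^* = (- conj s_2, conj s_1). *)
Definition spinor_star S (v : Cl) : Cl :=
  - (coord (spinor_basis S) 1 v)^* *: vplus S
  + (coord (spinor_basis S) 0 v)^* *: vminus S.

(* The variables being real, ( )^* acts on polynomials through their
   coefficients. *)
Definition poly_star S P : clpoly R := map_mpoly (spinor_star S) P.

Definition x1 : scpoly R := 'X_(0 : 'I_3).
Definition x2 : scpoly R := 'X_(1 : 'I_3).
Definition x3 : scpoly R := 'X_(2 : 'I_3).
Definition zvar : scpoly R := x1 + 'i *: x2.
Definition zbar : scpoly R := x1 - 'i *: x2.

Definition d1 P : clpoly R := mderiv (0 : 'I_3) P.
Definition d2 P : clpoly R := mderiv (1 : 'I_3) P.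
Definition d3 P : clpoly R := mderiv (2 : 'I_3) P.

(* {mpoly Cl[3]} is a left module over Cl, so complex scalars act on it
   through their images c%:A in Cl. *)
Definition dz P : clpoly R := (2^-1 : C)%:A *: (d1 P - ('i : C)%:A *: d2 P).
Definition dzbar P : clpoly R := (2^-1 : C)%:A *: (d1 P + ('i : C)%:A *: d2 P).

Definition dirac2 P : clpoly R := e1 *: d1 P + e2 *: d2 P.
Definition dirac3 P : clpoly R := dirac2 P + e3 *: d3 P.

(* e^(x_3 e_3 dirac2) P: for P of degree k, msize P = k + 1, so that the sum
   runs over s = 0, ..., k. *)
Definition ck_exp P : clpoly R :=
  \sum_(s < msize P)
     (s`!%:R^-1 : C)%:A *: ('X_(2 : 'I_3) ^+ s
                            * iter s (fun Q => e3 *: dirac2 Q) P).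

(* M_k(R^3, S). *)
Definition monogenic S (k : nat) P : Prop :=
  [/\ P \is k.-homog, forall m, P@_m \in spinor_space S & dirac3 P = 0].

(* The action of e_1 e_2, which spans so(2): the derivative at t = 0 of
   P |-> g P(g^-1 x g), where g = exp (t e_1 e_2). *)
Definition so2_act P : clpoly R :=
  (e1 * e2) *: P
  - 2 *: ('X_(0 : 'I_3) * d2 P - 'X_(1 : 'I_3) * d1 P).

(* f 0, ..., f (2k+1) is a basis of M_k(R^3, S) whose members span
   so(2)-stable lines that are pairwise non-isomorphic, i.e. on which e_1 e_2
   acts by pairwise distinct scalars. *)
Definition gelfand_tsetlin_basis S (k : nat) (f : nat -> clpoly R) : Prop :=
  [/\ forall j, (j <= k.*2.+1)%N -> monogenic S k (f j),
      forall P, monogenic S k P ->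
        exists! c : {ffun 'I_(k.*2.+2) -> C},
          P = \sum_(j < k.*2.+2) (c j)%:A *: f j &
      exists2 a : 'I_(k.*2.+2) -> C, injective a &
        forall j : 'I_(k.*2.+2), so2_act (f j) = (a j)%:A *: f j].

Definition zmonom (j l : nat) : scpoly R :=
  ((j`! * l`!)%N%:R^-1 : C) *: (zvar ^+ j * zbar ^+ l).

(* f^k_n, for n = 2j and n = 2j + 1 with 0 <= j <= k. *)
Definition gt_f S (k n : nat) : clpoly R :=
  let j := n./2 in
  ck_exp (cl_embed (if odd n then vminus S else vplus S) (zmonom j (k - j))).

Definition gt_p (k j : nat) : scpoly R :=
  \sum_(s < (minn j (k - j)).+1)
     ((-1) ^+ s / ((2 * s)`! * (j - s)`! * (k - j - s)`!)%N%:R : C)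
     *: ((2 *: x3) ^+ (2 * s) * zvar ^+ (j - s) * zbar ^+ (k - j - s)).

(* The range 0 <= s <= min(j - 1, k - j) is empty for j = 0 and j = k + 1. *)
Definition gt_q (k j : nat) : scpoly R :=
  if (0 < j <= k)%N then
    \sum_(s < (minn (j - 1) (k - j)).+1)
       ((-1) ^+ s / ((2 * s).+1`! * (j - 1 - s)`! * (k - j - s)`!)%N%:R : C)
       *: ((2 *: x3) ^+ (2 * s).+1 * zvar ^+ (j - 1 - s) * zbar ^+ (k - j - s))
  else 0.

End Spinors.

(* Main.v *)
Require Import Defs.
From HB Require Import structures.
From mathcomp Require Import all_boot all_order all_algebra.
From mathcomp Require Import reals complex mpoly zify ring.

Set Implicit Arguments.
Unset Strict Implicit.
Unset Printing Implicit Defensive.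

Import Order.TTheory GRing.Theory Num.Theory.
Local Open Scope ring_scope.

(** Written in coordinates, a spinor polynomial is a pair (g, h) of complex
polynomials, and the statement splits into the action of a few Clifford
elements on v^+ and v^- and the calculus of scalar polynomials.

On the Clifford side, wbar_1 and wbar_2 are isotropic and kill the idempotent,
so e_2 idem = - i e_1 idem, while w_1 and w_2 act on idem as e_1 and e_3.
Therefore e_3 e_1 and e_3 e_2 exchange v^+ and v^- up to scalars, and e_1 e_2
multiplies v^+ by i and v^- by - i ([vplus_action], [vminus_action]).  With sg
the sign of S, e_3 dirac2 becomes (g, h) |-> (2 sg dzbar h, - 2 sg dz g)
([ck_op]), whose square is - 4 dz dzbar.  The even and the odd powers of x_3 in
the exponential of a monomial thus sum separately, to a p and to a q
([ck_sum_even], [ck_sum_odd]): this is (a).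

For the calculus, the divided powers x^(n-1) / (n-1)!, set to 0 at n = 0, turn
p and q into the cases e = 0 and e = 1 of one alternating sum [solid e a b].
On it dz and dzbar decrement a and b, and d/dx_3 exchanges the two cases; as the
decrement is truncated at 0, where the sum vanishes, the boundary cases of (b)
need no separate treatment.  Conjugation exchanges z and zbar, hence a and b:
this is (c).

A pair is monogenic when d/dx_3 acts on it as e_3 dirac2 does ([dirac3_pair]).
Each f^k_n is an eigenvector of so(2), with eigenvalue i (1 + 2 k - 2 n)
([so2_gt]), so the eigenvalues are pairwise distinct.  That the f^k_n form a
basis follows from (b) by induction on k, without any dimension count.  If
sum_n c_n f^k_n = 0, applying dz and dzbar gives relations of degree k - 1 that
involve every c_n ([combination_free]).  If P is monogenic of degree k, then
dz P and dzbar P are combinations of the f^(k-1)_n, and since dz and dzbar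
commute the two families of coefficients fit together into those of one
combination of the f^k_n; its difference with P is killed by dz and dzbar, hence
by d/dx_3 as well, and a homogeneous polynomial of positive degree with zero
derivatives is zero ([combination_span]). *)

(** * Spinors in a Clifford algebra *)

Section AlgebraIdentities.
Variables (K : fieldType) (A : algType K) (i : K).
Hypotheses (ii : i * i = -1) (two_neq0 : 2 != 0 :> K).
Implicit Types (x y z t : A).

Lemma anticomm_comb {x y z t} (a b c d : K) :
  x * z = - (z * x) -> x * t = - (t * x) ->
  y * z = - (z * y) -> y * t = - (t * y) ->
  (a *: x + b *: y) * (c *: z + d *: t) =
  - ((c *: z + d *: t) * (a *: x + b *: y)).
Proof.
move=> xz xt yz yt; rewrite !mulrDl !mulrDr -!scalerAl -!scalerAr.
rewrite xz xt yz yt !scalerN !opprD !scalerA ![a * _]mulrC ![b * _]mulrC.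
by rewrite addrACA.
Qed.

Variables e1 e2 e3 e4 : A.
Hypotheses (e11 : e1 * e1 = -1) (e22 : e2 * e2 = -1).
Hypotheses (e33 : e3 * e3 = -1) (e44 : e4 * e4 = -1).
Hypotheses (e12 : e1 * e2 = - (e2 * e1)) (e13 : e1 * e3 = - (e3 * e1)).
Hypotheses (e14 : e1 * e4 = - (e4 * e1)) (e23 : e2 * e3 = - (e3 * e2)).
Hypotheses (e24 : e2 * e4 = - (e4 * e2)) (e34 : e3 * e4 = - (e4 * e3)).

Let w1 := 2^-1 *: (e1 + i *: e2).
Let w2 := 2^-1 *: (e3 + i *: e4).
Let wbar1 := 2^-1 *: (- e1 + i *: e2).
Let wbar2 := 2^-1 *: (- e3 + i *: e4).
Let idem := (wbar1 * w1) * (wbar2 * w2).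

Lemma wbar_sqr x y :
  x * x = -1 -> y * y = -1 -> x * y = - (y * x) ->
  (2^-1 *: (- x + i *: y)) * (2^-1 *: (- x + i *: y)) = 0.
Proof.
move=> xx yy xy; rewrite -scalerAl -scalerAr.
rewrite mulrDl !mulrDr !mulrNN xx !mulrN !mulNr.
rewrite -!scalerAl -!scalerAr [i *: (i *: _)]scalerA ii scaleN1r yy opprK xy.
by rewrite [i *: - _]scalerN opprK addrA addrK addNr !scaler0.
Qed.

Lemma wbar_w x y :
  x * x = -1 -> y * y = -1 -> x * y = - (y * x) ->
  2^-1 *: (- x + i *: y) * (2^-1 *: (x + i *: y)) =
  2^-1 *: (1 - i *: (x * y)).
Proof.
move=> xx yy xy; rewrite -scalerAl -scalerAr mulrDl !mulrDr !mulNr xx opprK.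
rewrite -!scalerAl -!scalerAr [i *: (i *: _)]scalerA ii scaleN1r yy opprK.
have -> : y * x = - (x * y) by rewrite xy opprK.
rewrite [i *: - _]scalerN addrACA [- _ + 1]addrC -mulr2n -scaler_nat !scalerA.
by rewrite -mulrA mulVf ?mulr1.
Qed.

Lemma wbar1_idem : wbar1 * idem = 0.
Proof. by rewrite !mulrA wbar_sqr // !mul0r. Qed.

(** wbar2 anticommutes with w1 and wbar1, so it moves past both and meets wbar2. *)
Lemma wbar2_idem : wbar2 * idem = 0.
Proof.
have anti c d : (c *: e1 + d *: e2) * wbar2 = - (wbar2 * (c *: e1 + d *: e2)).
  by rewrite /wbar2 scalerDr scalerN -scaleNr scalerA anticomm_comb.
have E1 : w1 * wbar2 = - (wbar2 * w1).
  by rewrite {1 2}/w1 scalerDr scalerA anti.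
have E2 : wbar1 * wbar2 = - (wbar2 * wbar1).
  by rewrite {1 2}/wbar1 scalerDr scalerN -scaleNr scalerA anti.
have -> : wbar2 * idem = wbar1 * w1 * (wbar2 * wbar2 * w2).
  rewrite /idem !mulrA -[wbar1 * w1 * wbar2]mulrA E1 mulrN !mulrA E2.
  by rewrite !mulNr opprK.
by rewrite wbar_sqr // mul0r mulr0.
Qed.

Lemma annihilated x y v : (2^-1 *: (- x + i *: y)) * v = 0 ->
  y * v = - i *: (x * v) /\ (2^-1 *: (x + i *: y)) * v = x * v.
Proof.
rewrite -!scalerAl => /eqP; rewrite scaler_eq0 invr_eq0 (negPf two_neq0) /=.
rewrite mulrDl mulNr addrC subr_eq0 -scalerAl => /eqP xy; split.
  by rewrite -xy scalerA mulNr ii opprK scale1r.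
by rewrite mulrDl -scalerAl xy -mulr2n -scaler_nat scalerA mulVf ?scale1r.
Qed.

Lemma e2_idem : e2 * idem = - i *: (e1 * idem).
Proof. by case: (annihilated wbar1_idem). Qed.

Lemma w1_idem : w1 * idem = e1 * idem.
Proof. by case: (annihilated wbar1_idem). Qed.

Lemma w2_idem : w2 * idem = e3 * idem.
Proof. by case: (annihilated wbar2_idem). Qed.

(** Expanded over the e_A, to show that idem is not 0: its scalar part is 1/4. *)
Lemma idemE :
  idem = (2^-1 * 2^-1) *: (1 - i *: (e1 * e2) - i *: (e3 * e4) - e1 * e2 * (e3 * e4)).
Proof.
rewrite /idem !wbar_w // -scalerAl -scalerAr scalerA mulrBl mul1r mulrBr mulr1.
rewrite -scalerAl -scalerAr scalerA ii scaleN1r opprK opprD.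
by rewrite !addrA [1 - _ - _]addrAC.
Qed.

Lemma w1w2_idem : w1 * w2 * idem = e1 * (e3 * idem).
Proof.
have w1e3 : w1 * e3 = - (e3 * w1).
  by rewrite /w1 -scalerAl -scalerAr mulrDl mulrDr -scalerAl -scalerAr e13 e23
             scalerN -opprD scalerN.
rewrite -[LHS]mulrA w2_idem [LHS]mulrA w1e3 mulNr -[_ * w1 * idem]mulrA w1_idem.
by rewrite [in RHS]mulrA e13 mulNr mulrA.
Qed.

Local Lemma act_sqr {x} y : x * x = -1 -> x * (x * y) = - y.
Proof. by move=> xx; rewrite mulrA xx mulN1r. Qed.

Local Lemma act_anti {x y} z : x * y = - (y * x) -> y * (x * z) = - (x * (y * z)).
Proof. by move=> xy; rewrite !mulrA xy mulNr opprK. Qed.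

(** As (x y)^2 = -1, the image of v under x y determines that of x y v. *)
Lemma swap_back x y (c d : K) v w : x * x = -1 -> y * y = -1 ->
  x * y = - (y * x) -> c * d = -1 ->
  x * (y * v) = c *: w -> x * (y * w) = d *: v.
Proof.
move=> xx yy xy cd vw; have: x * (y * (x * (y * v))) = - v.
  by rewrite (act_anti _ xy) mulrN (act_sqr _ xx) opprK (act_sqr _ yy).
rewrite vw -!scalerAr => /(congr1 ( *:%R d)).
by rewrite scalerA mulrC cd scaleN1r scalerN => /oppr_inj.
Qed.

(** The eigenvalues i and - i of x y are distinct. *)
Lemma eigen_free x y v w : i != 0 -> v != 0 -> w != 0 ->
  x * (y * v) = i *: v -> x * (y * w) = - i *: w ->
  forall a b : K, a *: v + b *: w = 0 -> a = 0 /\ b = 0.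
Proof.
move=> i0 v0 w0 xyv xyw a b E0.
have E1 : a *: v - b *: w = 0.
  apply: (@scalerI _ _ i) => //; rewrite scaler0 scalerBr !scalerA.
  rewrite ![i * _]mulrC -!scalerA -xyv -[- (b *: _)]scalerN -scaleNr -xyw.
  by rewrite !scalerAr -!mulrDr E0 !mulr0.
have a0 : a = 0.
  have/eqP: 2 * a *: v = 0.
    rewrite -scalerA scaler_nat mulr2n -[X in X + _](addrK (b *: w)) E0 sub0r.
    by rewrite addrC E1.
  by rewrite scaler_eq0 (negPf v0) orbF mulf_eq0 (negPf two_neq0) => /eqP.
split=> //; move/eqP: E0.
by rewrite a0 scale0r add0r scaler_eq0 (negPf w0) orbF => /eqP.
Qed.

(** With v = idem, these are the vectors v and e1 e3 v = v^- of S^+. *)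
Lemma even_spinor_action v : e2 * v = - i *: (e1 * v) ->
  [/\ e3 * (e1 * v) = - (e1 * (e3 * v)),
      e3 * (e2 * v) = i *: (e1 * (e3 * v)),
      e1 * (e2 * v) = i *: v &
      e1 * (e2 * (e1 * (e3 * v))) = - i *: (e1 * (e3 * v))].
Proof.
move=> ev; have e31 := act_anti v e13.
split=> //.
- by rewrite ev -scalerAr e31 scalerN scaleNr opprK.
- by rewrite ev -scalerAr act_sqr // scalerN scaleNr opprK.
- rewrite (act_anti _ e12) mulrN act_sqr // opprK.
  by rewrite -[LHS]opprK -(act_anti _ e23) ev -scalerAr e31 !scaleNr scalerN opprK.
Qed.

(** With v = idem, these are the vectors e3 v = v^+ and e1 v = v^- of S^-. *)
Lemma odd_spinor_action v : e2 * v = - i *: (e1 * v) ->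
  [/\ e3 * (e1 * (e3 * v)) = e1 * v,
      e3 * (e2 * (e3 * v)) = - i *: (e1 * v),
      e1 * (e2 * (e3 * v)) = i *: (e3 * v) &
      e1 * (e2 * (e1 * v)) = - i *: (e1 * v)].
Proof.
move=> ev; split.
- by rewrite (act_anti _ e13) act_sqr // mulrN opprK.
- by rewrite (act_anti _ e23) act_sqr // mulrN opprK.
- rewrite -[e2 * _]opprK -(act_anti _ e23) mulrN -(act_anti _ e13).
  by rewrite ev -scalerAr act_sqr // scalerN scaleNr opprK scalerAr.
- by rewrite (act_anti _ e12) mulrN act_sqr // opprK.
Qed.

End AlgebraIdentities.

Section SpinorAction.
Variable R : realType.
Local Notation C := R[i].
Local Notation Cl := (Cl4 R).
Implicit Types (S : spin_sign).

Lemma two_neq0 : 2 != 0 :> C. Proof. by rewrite pnatr_eq0. Qed.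
Lemma iC2 : 'i * 'i = -1 :> C. Proof. by rewrite -expr2 sqrCi. Qed.

Lemma e_sqr (j : 'I_4) : cl_gen C j * cl_gen C j = -1.
Proof. exact: cl_gen_sqr. Qed.
Lemma e_anti (j k : 'I_4) : j != k ->
  cl_gen C j * cl_gen C k = - (cl_gen C k * cl_gen C j).
Proof. exact: cl_gen_anticomm. Qed.

Ltac clifford_rel := first [exact: e_sqr | exact: e_anti].

Lemma idem_action :
  [/\ e2 R * idem R = - 'i *: (e1 R * idem R), w1 R * idem R = e1 R * idem R,
      w2 R * idem R = e3 R * idem R &
      w1 R * w2 R * idem R = e1 R * (e3 R * idem R)].
Proof.
split.
- apply: (e2_idem iC2 two_neq0); clifford_rel.
- apply: (w1_idem iC2 two_neq0); clifford_rel.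
- apply: (w2_idem iC2 two_neq0); clifford_rel.
- apply: (w1w2_idem iC2 two_neq0); clifford_rel.
Qed.

Lemma idem_neq0 : idem R != 0.
Proof.
have E : idem R = (2^-1 * 2^-1) *: (1 - 'i *: (e1 R * e2 R) - 'i *: (e3 R * e4 R)
                   - e1 R * e2 R * (e3 R * e4 R)).
  by apply: (idemE iC2 two_neq0); clifford_rel.
have cl0 (A : {set 'I_4}) (j : 'I_4) : j \in A -> cl_basis C A set0 = 0.
  by move=> jA; rewrite ffunE; case: eqP => // A0; rewrite -A0 inE in jA.
have clZ (a : C) (x : Cl) : (a *: x) set0 = a * x set0 by exact: ffunE.
have coefB (a : C) (x y : Cl) : y set0 = 0 -> (x - a *: y) set0 = x set0.
  move=> y0; have -> : (x - a *: y) set0 = x set0 - (a *: y) set0.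
    by rewrite ffunE; congr (_ + _); apply: ffunE.
  by rewrite clZ y0 mulr0 subr0.
have coef1 : (1 : Cl) set0 = 1 by rewrite ffunE eqxx.
have coef0 (a b c d : C) (x y z : Cl) : x set0 = 0 -> y set0 = 0 -> z set0 = 0 ->
    (a *: (1 - 'i *: (b *: x) - 'i *: (c *: y) - d *: z)) set0 = a.
  move=> x0 y0 z0; rewrite clZ coefB // coefB ?clZ ?y0 ?mulr0 //.
  by rewrite coefB ?clZ ?x0 ?mulr0 // coef1 mulr1.
(* e1 e2, e3 e4 and their product are multiples of e_A with A not empty, so they
   have no scalar part. *)
have e_basis (a b : 'I_4) : exists c : C,
    cl_gen C a * cl_gen C b = c *: cl_basis C (symdiff [set a] [set b]).
  by eexists; apply: cl_basisM.
have basisM (a b : C) (A B : {set 'I_4}) : exists c : C,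
    (a *: cl_basis C A) * (b *: cl_basis C B) = c *: cl_basis C (symdiff A B).
  by eexists; rewrite -scalerAl -scalerAr cl_basisM !scalerA.
have [c12 E12] := e_basis 0 1; have [c34 E34] := e_basis 2 3.
have [c Ec] := basisM c12 c34 (symdiff [set 0] [set 1]) (symdiff [set 2] [set 3]).
apply/eqP => /ffunP/(_ set0); rewrite E E12 E34 Ec coef0.
- by rewrite ffunE => /eqP; rewrite mulf_eq0 !invr_eq0 (negPf two_neq0).
- by apply: (cl0 _ 0); rewrite in_symdiff !inE.
- by apply: (cl0 _ 2); rewrite in_symdiff !inE.
- by apply: (cl0 _ 0); rewrite !in_symdiff !inE.
Qed.

Lemma vplusE S :
  vplus R S = if S is Splus then idem R else e3 R * idem R.
Proof. by have [_ _ W2 _] := idem_action; case: S; last exact: W2. Qed.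

Lemma vminusE S :
  vminus R S = if S is Splus then e1 R * (e3 R * idem R) else e1 R * idem R.
Proof.
by have [_ W1 _ W12] := idem_action; case: S; [exact: W12 | exact: W1].
Qed.

Lemma vplus_action S :
  [/\ e3 R * (e1 R * vplus R S) = - pm R S *: vminus R S,
      e3 R * (e2 R * vplus R S) = ('i * pm R S) *: vminus R S,
      e1 R * (e2 R * vplus R S) = 'i *: vplus R S &
      e1 R * (e2 R * vminus R S) = - 'i *: vminus R S].
Proof.
have e11 := e_sqr 0; have e12 := @e_anti 0 1 isT; have e13 := @e_anti 0 2 isT.
have e23 := @e_anti 1 2 isT; have e33 := e_sqr 2.
have [I2 _ _ _] := idem_action; rewrite vplusE vminusE; case: S; rewrite /pm.
  have [a1 a2 a3 a4] := even_spinor_action e11 e12 e13 e23 I2.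
  rewrite (mulr1 'i) scaleN1r; split; [exact: a1 | exact: a2 | exact: a3 | exact: a4].
have [a1 a2 a3 a4] := odd_spinor_action e11 e33 e12 e13 e23 I2.
rewrite opprK scale1r mulrN1; split; [exact: a1 | exact: a2 | exact: a3 | exact: a4].
Qed.

Lemma pm_sqr S : pm R S * pm R S = 1.
Proof. by case: S; rewrite /pm ?mulr1 ?mulrNN ?mulr1. Qed.

Lemma vminus_action S :
  e3 R * (e1 R * vminus R S) = pm R S *: vplus R S /\
  e3 R * (e2 R * vminus R S) = ('i * pm R S) *: vplus R S.
Proof.
have [a1 a2 _ _] := vplus_action S.
have e11 := e_sqr 0; have e22 := e_sqr 1; have e33 := e_sqr 2.
have e31 := @e_anti 2 0 isT; have e32 := @e_anti 2 1 isT.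
split; [apply: (swap_back e33 e11 e31 _ a1)|apply: (swap_back e33 e22 e32 _ a2)].
  by rewrite mulNr pm_sqr.
by rewrite mulrACA pm_sqr mulr1 iC2.
Qed.

Lemma spinor_free S (a b : C) :
  a *: vplus R S + b *: vminus R S = 0 -> a = 0 /\ b = 0.
Proof.
have [a1 _ a3 a4] := vplus_action S.
have e11 := e_sqr 0; have e33 := e_sqr 2.
have e_inj (x y : Cl) : x * x = -1 -> x * y = 0 -> y = 0.
  by move=> xx xy; rewrite -[y]opprK -(act_sqr y xx) xy mulr0 oppr0.
have vp0 : vplus R S != 0.
  apply/eqP; rewrite vplusE; case: S {a1 a3 a4} => [|/(e_inj _ _ e33)];
  by apply/eqP; apply: idem_neq0.
have vm0 : vminus R S != 0.
  apply/eqP => m0; move: a1; rewrite m0 scaler0 => /(e_inj _ _ e33)/(e_inj _ _ e11).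
  by apply/eqP.
have i0 : 'i != 0 :> C by exact: neq0Ci.
exact: (eigen_free two_neq0 i0 vp0 vm0 a3 a4).
Qed.

End SpinorAction.

(** * Alternating sums of divided powers *)

Section DividedPowers.
Variables (K : numFieldType) (A : comAlgType K).
Implicit Types (x : A) (n a b s : nat).

(** The divided power of exponent n - 1, with value 0 at n = 0: a derivation maps
it to the one of index n.-1 for every n, including n = 0 and n = 1. *)
Definition dpow x n : A := if n is m.+1 then m`!%:R^-1 *: x ^+ m else 0.
Arguments dpow : simpl never.

Lemma mul_dpow x n : x * dpow x n = n%:R *: dpow x n.+1.
Proof.
rewrite /dpow; case: n => [|n]; first by rewrite mulr0 scale0r.
rewrite -scalerAr -exprS scalerA factS natrM invfM mulrA divff ?mul1r //.
by rewrite pnatr_eq0.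
Qed.

Variables t z w : A.

(** For a = j + 1 and b = k - j + 1, with t = 2 x_3 and w = zbar, this is the s-th
term of p^k_j if e = 0; for a = j instead it is that of q^k_j if e = 1. *)
Definition h_term e a b s : A :=
  (-1) ^+ s *: (dpow t (2 * s + e).+1 * dpow z (a - s) * dpow w (b - s)).

Definition harmonic e a b : A := \sum_(s < minn a b) h_term e a b s.

Lemma h_term0 e a b s : (minn a b <= s)%N -> h_term e a b s = 0.
Proof.
rewrite geq_min /h_term /dpow => /orP[] /eqP->; first by rewrite mulr0 mul0r scaler0.
by rewrite mulr0 scaler0.
Qed.

(** Terms with s >= min(a, b) vanish, so sums for different a and b can be
compared over a common range. *)
Lemma harmonic_widen e a b n : (minn a b <= n)%N ->
  harmonic e a b = \sum_(s < n) h_term e a b s.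
Proof.
move=> le; rewrite /harmonic (big_ord_widen _ (h_term e a b) le) big_mkcond /=.
by apply: eq_bigr => s _; case: ltnP => // /h_term0->.
Qed.

Lemma harmonic0 e a b : (a == 0)%N || (b == 0)%N -> harmonic e a b = 0.
Proof.
by case/orP=> /eqP->; rewrite /harmonic ?min0n ?minn0 big_ord0.
Qed.

Section Derivation.
Variable D : {linear A -> A}.
Hypothesis DM : forall x y : A, D (x * y) = D x * y + x * D y.

Lemma derivation_dpow x n : D (dpow x n) = D x * dpow x n.-1.
Proof.
have D1 : D 1 = 0.
  have /eqP := DM 1 1; rewrite !mulr1 mul1r -subr_eq0 opprD addrA subrr sub0r.
  by rewrite oppr_eq0 => /eqP.
case: n => [|n]; first by rewrite /dpow raddf0 mulr0.
rewrite /dpow linearZ /=; have Dx m : D (x ^+ m.+1) = m.+1%:R *: (D x * x ^+ m).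
  elim: m => [|m IH]; first by rewrite expr1 mulr1 scale1r.
  rewrite exprS DM IH -scalerAr mulrCA -exprS -[X in X + _]scale1r -scalerDl.
  by rewrite nat1r.
case: n => [|n]; first by rewrite D1 scaler0 mulr0.
rewrite Dx scalerA factS natrM invfM mulrC mulrA divff ?pnatr_eq0 //.
by rewrite mul1r /= scalerAr.
Qed.

(** Lowering the index of dpow commutes with the truncated shift by s. *)
Lemma derivation_harmonic e a b :
  D (harmonic e a b) = D z * harmonic e a.-1 b + D w * harmonic e a b.-1 +
    D t * \sum_(s < minn a b)
       (-1) ^+ s *: (dpow t (2 * s + e) * dpow z (a - s) * dpow w (b - s)).
Proof.
rewrite (@harmonic_widen e a.-1 b (minn a b)); last by lia.
rewrite (@harmonic_widen e a b.-1 (minn a b)); last by lia.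
rewrite /harmonic linear_sum !mulr_sumr -!big_split; apply: eq_bigr => s _ /=.
rewrite /h_term linearZ /= !DM !derivation_dpow /= -!scalerAr -!scalerDr.
have -> : (a - s).-1 = (a.-1 - s)%N by lia.
have -> : (b - s).-1 = (b.-1 - s)%N by lia.
congr (_ *: _); ring.
Qed.

(** The term s = 0 does not contain t, and s |-> s + 1 turns the remaining terms
into those of a sum with e = 1. *)
Lemma derivation_harmonic0 a b :
  D (harmonic 0 a b) = D z * harmonic 0 a.-1 b + D w * harmonic 0 a b.-1
    - D t * harmonic 1 a.-1 b.-1.
Proof.
rewrite derivation_harmonic -mulrN; congr (_ + _ * _).
rewrite /harmonic; have -> : minn a.-1 b.-1 = (minn a b).-1 by lia.
case: (minn a b) => [|n]; first by rewrite !big_ord0 oppr0.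
rewrite big_ord_recl {1}/dpow /= !mul0r scaler0 add0r -sumrN.
apply: eq_bigr => s _; rewrite /h_term /bump /= add1n exprS mulN1r scaleNr.
have -> : (2 * s.+1 + 0 = (2 * s + 1).+1)%N by lia.
have -> : (a - s.+1 = a.-1 - s)%N by lia.
by have -> : (b - s.+1 = b.-1 - s)%N by lia.
Qed.

Lemma derivation_harmonic1 a b :
  D (harmonic 1 a b) = D z * harmonic 1 a.-1 b + D w * harmonic 1 a b.-1
    + D t * harmonic 0 a b.
Proof.
rewrite derivation_harmonic; congr (_ + _ * _); apply: eq_bigr => s _.
by rewrite /h_term addn0 addn1.
Qed.

End Derivation.

(** Every term has degree a - s - 1 in z and b - s - 1 in w, and the difference
of these degrees does not depend on s. *)
Lemma rotation_harmonic e a b :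
  z * harmonic e a.-1 b - w * harmonic e a b.-1 = (a%:R - b%:R) *: harmonic e a b.
Proof.
rewrite (@harmonic_widen e a.-1 b (minn a b)); last by lia.
rewrite (@harmonic_widen e a b.-1 (minn a b)); last by lia.
rewrite /harmonic !mulr_sumr -sumrB scaler_sumr; apply: eq_bigr => s _.
have [sa sb] : (s < a)%N /\ (s < b)%N by have := ltn_ord s; lia.
rewrite /h_term -!scalerAr -scalerBr [RHS]scalerA [X in _ = X *: _]mulrC -[RHS]scalerA.
congr (_ *: _).
have -> : z * (dpow t (2 * s + e).+1 * dpow z (a.-1 - s) * dpow w (b - s)) =
   dpow t (2 * s + e).+1 * (z * dpow z (a.-1 - s)) * dpow w (b - s).
  by rewrite !mulrA [z * _]mulrC.
have -> : w * (dpow t (2 * s + e).+1 * dpow z (a - s) * dpow w (b.-1 - s)) =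
   dpow t (2 * s + e).+1 * dpow z (a - s) * (w * dpow w (b.-1 - s)).
  by rewrite mulrCA.
rewrite !mul_dpow.
have -> : ((a.-1 - s).+1 = a - s)%N by lia.
have -> : ((b.-1 - s).+1 = b - s)%N by lia.
rewrite -!scalerAr -scalerAl -scalerBl; congr (_ *: _).
have Ea : a%:R = (a.-1 - s)%:R + s.+1%:R :> K by rewrite -natrD; congr _%:R; lia.
have Eb : b%:R = (b.-1 - s)%:R + s.+1%:R :> K by rewrite -natrD; congr _%:R; lia.
by rewrite Ea Eb opprD addrACA subrr addr0.
Qed.

End DividedPowers.

Section Conjugation.
Variables (K : numFieldType) (A : comAlgType K).
Variables (f : {rmorphism A -> A}) (g : {rmorphism K -> K}).
Hypothesis fZ : forall c (x : A), f (c *: x) = g c *: f x.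

Lemma rmorph_dpow x n : f (dpow x n) = dpow (f x) n.
Proof.
by rewrite /dpow; case: n => [|n]; rewrite ?rmorph0 // fZ rmorphXn fmorphV rmorph_nat.
Qed.

Lemma rmorph_harmonic t z w e a b : f t = t -> f z = w -> f w = z ->
  f (harmonic t z w e a b) = harmonic t z w e b a.
Proof.
move=> ft fz fw; rewrite /harmonic rmorph_sum minnC; apply: eq_bigr => s _ /=.
rewrite /h_term fZ !rmorphM !rmorph_dpow ft fz fw rmorphXn rmorphN1 -!mulrA.
by rewrite [dpow w _ * _]mulrC.
Qed.

End Conjugation.

(** * Pairs of scalar polynomials *)

Section HarmonicPairs.
Variable K : numClosedFieldType.
Local Notation G := {mpoly K[3]}.
Implicit Types (g h : G) (c : K) (i : 'I_3) (e a b k : nat).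

Local Notation X1 := ('X_(0 : 'I_3) : G).
Local Notation X2 := ('X_(1 : 'I_3) : G).
Local Notation X3 := ('X_(2 : 'I_3) : G).
Local Notation d1 := (mderiv (0 : 'I_3)).
Local Notation d2 := (mderiv (1 : 'I_3)).
Local Notation d3 := (mderiv (2 : 'I_3)).

Definition zpoly : G := X1 + 'i *: X2.
Definition zbarpoly : G := X1 - 'i *: X2.

Definition solid e a b : G := harmonic (2 *: X3) zpoly zbarpoly e a b.

Lemma mderiv_X i (j : 'I_3) : mderiv i ('X_j : G) = (i == j)%:R.
Proof.
rewrite mderivX mnm1E eq_sym; case: eqP => [->|_]; last by rewrite scale0r.
by rewrite scale1r -[X in 'X_[X - _]]add0m addmK mpolyX0.
Qed.

Lemma d12_zpoly : [/\ d1 zpoly = 1%:A, d1 zbarpoly = 1%:A,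
  d2 zpoly = 'i%:A & d2 zbarpoly = (- 'i)%:A].
Proof.
rewrite /zpoly /zbarpoly !mderivD !mderivN !mderivZ !mderiv_X scaleNr scale1r.
by split; rewrite ?scaler0 ?subr0 ?addr0 ?add0r ?sub0r.
Qed.

Lemma mderiv_solid12 i c c' e a b :
  mderiv i zpoly = c%:A -> mderiv i zbarpoly = c'%:A -> mderiv i X3 = 0 ->
  mderiv i (solid e a b) = c *: solid e a.-1 b + c' *: solid e a b.-1.
Proof.
move=> zi zbi ti; rewrite /solid (@derivation_harmonic K G _ _ _ (mderiv i) (mderivM i)).
by rewrite /= mderivZ zi zbi ti !mulr_algl scaler0 mul0r addr0.
Qed.

Lemma d1_solid e a b : d1 (solid e a b) = solid e a.-1 b + solid e a b.-1.
Proof.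
have [z1 zb1 _ _] := d12_zpoly.
by rewrite (mderiv_solid12 _ _ _ z1 zb1) ?mderiv_X // !scale1r.
Qed.

Lemma d2_solid e a b :
  d2 (solid e a b) = 'i *: solid e a.-1 b - 'i *: solid e a b.-1.
Proof.
have [_ _ z2 zb2] := d12_zpoly.
by rewrite (mderiv_solid12 _ _ _ z2 zb2) ?mderiv_X // scaleNr.
Qed.

Local Lemma d3_zero : d3 zpoly = 0 /\ d3 zbarpoly = 0 /\ d3 (2 *: X3) = 2 *: 1.
Proof.
split; first by rewrite /zpoly mderivD mderivZ !mderiv_X scaler0 addr0.
split; first by rewrite /zbarpoly mderivB mderivZ !mderiv_X scaler0 subr0.
by rewrite mderivZ mderiv_X.
Qed.

Lemma d3_solid0 a b : d3 (solid 0 a b) = - 2 *: solid 1 a.-1 b.-1.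
Proof.
have [z0 [zb0 t0]] := d3_zero.
rewrite /solid (@derivation_harmonic0 K G _ _ _ d3 (mderivM _)) /= z0 zb0 t0 !mul0r !add0r.
by rewrite -scalerAl mul1r scaleNr.
Qed.

Lemma d3_solid1 a b : d3 (solid 1 a b) = 2 *: solid 0 a b.
Proof.
have [z0 [zb0 t0]] := d3_zero.
rewrite /solid (@derivation_harmonic1 K G _ _ _ d3 (mderivM _)) /= z0 zb0 t0 !mul0r !add0r.
by rewrite -scalerAl mul1r.
Qed.

(** The Wirtinger derivatives, on scalar polynomials. *)
Definition sdz g : G := 2^-1 *: (d1 g - 'i *: d2 g).
Definition sdzbar g : G := 2^-1 *: (d1 g + 'i *: d2 g).

Lemma scale_mul2_half c g : (c * 2) *: (2^-1 *: g) = c *: g.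
Proof. by rewrite scalerA mulfK ?pnatr_eq0. Qed.

Lemma half_addrr g : 2^-1 *: (g + g) = g.
Proof. by rewrite -mulr2n -scaler_nat scalerA mulVf ?pnatr_eq0 ?scale1r. Qed.

(** In effect the chain rule: p and q are the partial derivatives of g with
respect to z and zbar. *)
Lemma wirtinger g p q : d1 g = p + q -> d2 g = 'i *: p - 'i *: q ->
  sdz g = p /\ sdzbar g = q.
Proof.
move=> E1 E2; rewrite /sdz /sdzbar E1 E2 ['i *: (_ - _)]scalerBr !['i *: ('i *: _)]scalerA.
rewrite -expr2 sqrCi !scaleN1r opprK; split.
  by rewrite opprD opprK addrACA subrr addr0 half_addrr.
by rewrite addrACA subrr add0r half_addrr.
Qed.

Lemma sdz_solid e a b : sdz (solid e a b) = solid e a.-1 b.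
Proof. by have [] := wirtinger (d1_solid e a b) (d2_solid e a b). Qed.

Lemma sdzbar_solid e a b : sdzbar (solid e a b) = solid e a b.-1.
Proof. by have [] := wirtinger (d1_solid e a b) (d2_solid e a b). Qed.

Lemma sdz_is_linear : linear sdz.
Proof.
move=> c g h; rewrite /sdz !mderivD !mderivZ scalerA mulrC -scalerA -scalerDr.
congr (_ *: _); rewrite scalerBr !scalerDr !scalerA ['i * c]mulrC.
by rewrite opprD addrACA.
Qed.
HB.instance Definition _ := GRing.isLinear.Build K G G _ sdz sdz_is_linear.

Lemma sdzbar_is_linear : linear sdzbar.
Proof.
move=> c g h; rewrite /sdzbar !mderivD !mderivZ scalerA mulrC -scalerA -scalerDr.
congr (_ *: _); rewrite !scalerDr !scalerA ['i * c]mulrC.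
by rewrite addrACA.
Qed.
HB.instance Definition _ := GRing.isLinear.Build K G G _ sdzbar sdzbar_is_linear.

Lemma solid0 e a b : (a == 0)%N || (b == 0)%N -> solid e a b = 0.
Proof. exact: harmonic0. Qed.

(** x_1 d/dx_2 - x_2 d/dx_1 = i (z d/dz - zbar d/dzbar). *)
Lemma rotation_solid e a b :
  X1 * d2 (solid e a b) - X2 * d1 (solid e a b) =
  ('i * (a%:R - b%:R)) *: solid e a b.
Proof.
have H := @rotation_harmonic K G (2 *: X3) zpoly zbarpoly e a b.
rewrite -[RHS]scalerA /solid -H -!/(solid _ _ _) d1_solid d2_solid.
move: (solid _ a.-1 b) (solid _ a b.-1) => P Q; rewrite /zpoly /zbarpoly.
have [I II IE] : exists2 I : G, I * I = -1 & forall g, 'i *: g = I * g.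
  exists 'i%:A => [|g]; last by rewrite mulr_algl.
  by rewrite mulr_algl scalerA -expr2 sqrCi scaleN1r.
rewrite !IE.
transitivity (I * X1 * P - I * X1 * Q + (I * I) * (X2 * P + X2 * Q)).
  by rewrite II; ring.
by ring.
Qed.

Lemma dpow_homog (x : G) n : x \is 1.-homog -> dpow x n \is (n.-1).-homog.
Proof.
move=> x1; rewrite /dpow; case: n => [|n]; first exact: dhomog0.
by apply: dhomogZ; have := dhomogMn n x1; rewrite mul1n.
Qed.

Lemma X_homog i : ('X_i : G) \is 1.-homog.
Proof. by rewrite dhomogX /= mdeg1. Qed.

Lemma solid_homog e a b : solid e a.+1 b.+1 \is (a + b + e).-homog.
Proof.
have z1 : zpoly \is 1.-homog by rewrite /zpoly rpredD ?rpredZ ?X_homog.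
have zb1 : zbarpoly \is 1.-homog by rewrite /zbarpoly rpredB ?rpredZ ?X_homog.
have t1 : 2 *: X3 \is 1.-homog by rewrite rpredZ ?X_homog.
apply: rpred_sum => s _; apply: rpredZ.
have -> : (a + b + e = (2 * s + e).+1.-1 + (a.+1 - s).-1 + (b.+1 - s).-1)%N.
  by have := ltn_ord s; lia.
by rewrite !dhomogM ?dpow_homog.
Qed.

Lemma mderiv_homog k i g : g \is k.+1.-homog -> mderiv i g \is k.-homog.
Proof.
move=> gk; apply/dhomogP => m; rewrite mcoeff_msupp mcoeff_deriv => nz.
have: (m + U_(i))%MM \in msupp g.
  by rewrite mcoeff_msupp; apply: contraNneq nz => ->; rewrite mul0rn.
by move/(dhomog_mf gk) => /=; rewrite mdegD mdeg1 addn1 => -[].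
Qed.

Variable sg : K.
Hypothesis sg_sqr : sg * sg = 1.
Local Notation W := (G * G)%type.
Implicit Type u : W.

Definition dz_pair u : W := (sdz u.1, sdz u.2).
Definition dzbar_pair u : W := (sdzbar u.1, sdzbar u.2).
Definition d3_pair u : W := (d3 u.1, d3 u.2).

Lemma dz_pair_is_linear : linear dz_pair.
Proof. by move=> c u u'; rewrite /dz_pair !linearP. Qed.
HB.instance Definition _ := GRing.isLinear.Build K W W _ dz_pair dz_pair_is_linear.

Lemma dzbar_pair_is_linear : linear dzbar_pair.
Proof. by move=> c u u'; rewrite /dzbar_pair !linearP. Qed.
HB.instance Definition _ :=
  GRing.isLinear.Build K W W _ dzbar_pair dzbar_pair_is_linear.

(** The coordinates of the exponential of [zmon a b], the monomial of degrees
a - 1 in z and b - 1 in zbar, times v^- if o and v^+ otherwise. *)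
Definition gt_pair (o : bool) a b : W :=
  if o then (sg *: solid 1 a b.-1, solid 0 a b)
  else (solid 0 a b, - sg *: solid 1 a.-1 b).

Lemma gt_pair0 o a b : (a == 0)%N || (b == 0)%N -> gt_pair o a b = 0.
Proof.
move=> ab; rewrite /gt_pair !solid0 //.
- by case: o; rewrite scaler0.
- by case/orP: ab => /eqP->; rewrite ?eqxx ?orbT.
- by case/orP: ab => /eqP->; rewrite ?eqxx ?orbT.
Qed.

Lemma dz_gt_pair o a b : dz_pair (gt_pair o a b) = gt_pair o a.-1 b.
Proof. by rewrite /gt_pair /dz_pair; case: o; rewrite /= linearZ /= !sdz_solid. Qed.

Lemma dzbar_gt_pair o a b : dzbar_pair (gt_pair o a b) = gt_pair o a b.-1.
Proof.
by rewrite /gt_pair /dzbar_pair; case: o; rewrite /= linearZ /= !sdzbar_solid.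
Qed.

Lemma d3_gt_pair0 a b :
  d3_pair (gt_pair false a b) = (- sg * 2) *: gt_pair true a.-1 b.
Proof.
rewrite /gt_pair /d3_pair /= mderivZ d3_solid0 d3_solid1.
congr (_, _); rewrite ?scalerA //.
by rewrite mulrAC !mulNr sg_sqr mul1r.
Qed.

Lemma d3_gt_pair1 a b :
  d3_pair (gt_pair true a b) = (sg * 2) *: gt_pair false a b.-1.
Proof.
rewrite /gt_pair /d3_pair /= mderivZ d3_solid0 d3_solid1.
congr (_, _); rewrite ?scalerA //.
by rewrite mulrAC mulrN sg_sqr mulN1r.
Qed.

(** The coordinates of f^k_n for n <= 2 k + 1; the truncated subtraction makes
it vanish for larger n. *)
Definition gt_coord k n : W := gt_pair (odd n) n./2.+1 (k.+1 - n./2).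

Lemma dzbar_gt k n : dzbar_pair (gt_coord k.+1 n) = gt_coord k n.
Proof. by rewrite /gt_coord dzbar_gt_pair; congr gt_pair; lia. Qed.

Lemma dz_gt k n : dz_pair (gt_coord k.+1 n.+2) = gt_coord k n.
Proof. by rewrite /gt_coord dz_gt_pair /= negbK; congr gt_pair; lia. Qed.

Lemma dz_gt0 k n : (n < 2)%N -> dz_pair (gt_coord k n) = 0.
Proof. by case: n => [|[|n]] // _; rewrite /gt_coord dz_gt_pair gt_pair0. Qed.

Lemma gt_out k n : (k.*2.+1 < n)%N -> gt_coord k n = 0.
Proof.
move=> lt; rewrite /gt_coord gt_pair0 //; apply/orP; right; apply/eqP.
have := odd_double_half n; lia.
Qed.

Lemma d3_gt k n :
  d3_pair (gt_coord k.+1 n.+1) = (- sg * (-1) ^+ n.+1 * 2) *: gt_coord k n.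
Proof.
rewrite /gt_coord -signr_odd; have := odd_double_half n; rewrite [odd n.+1]/=.
case: (odd n) => /= En.
  rewrite d3_gt_pair0 expr0 mulr1; congr (_ *: gt_pair _ _ _); lia.
rewrite d3_gt_pair1 expr1 mulrN1 opprK; congr (_ *: gt_pair _ _ _); lia.
Qed.

Lemma d3_gt0 k : d3_pair (gt_coord k 0) = 0.
Proof. by rewrite /gt_coord d3_gt_pair0 gt_pair0 ?scaler0. Qed.

(** The operator e_3 dirac2 in the coordinates along v^+ and v^-. *)
Definition ck_op u : W := ((sg * 2) *: sdzbar u.2, (- sg * 2) *: sdz u.1).

Definition monogenic_pair k u : Prop :=
  [/\ u.1 \is k.-homog, u.2 \is k.-homog & d3_pair u = ck_op u].

Lemma monogenic_gt k n : (n <= k.*2.+1)%N -> monogenic_pair k (gt_coord k n).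
Proof.
move=> nk; have sg2 : - sg * 2 * sg = -2 by rewrite mulrAC mulNr sg_sqr mulN1r.
have sg2' : sg * 2 * - sg = -2 by rewrite mulrAC mulrN sg_sqr mulN1r.
have S e a b m : (0 < a -> 0 < b -> a.-1 + b.-1 + e = m)%N ->
    solid e a b \is m.-homog.
  case: a => [|a]; first by rewrite solid0 ?dhomog0.
  case: b => [|b]; first by rewrite solid0 ?orbT ?dhomog0.
  by move=> <- //; apply: solid_homog.
have := odd_double_half n; rewrite /gt_coord; case: (odd n) => /= En.
  split; rewrite /=; [apply: rpredZ; apply: S; lia | apply: S; lia |].
  rewrite /d3_pair /ck_op /= mderivZ d3_solid1 d3_solid0 sdzbar_solid [sdz (_ *: _)]linearZ /=.
  by rewrite sdz_solid !scalerA sg2.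
split; rewrite /=; [apply: S; lia | apply: rpredZ; apply: S; lia |].
rewrite /d3_pair /ck_op /= mderivZ d3_solid1 d3_solid0 sdz_solid [sdzbar (_ *: _)]linearZ /=.
by rewrite sdzbar_solid !scalerA sg2'.
Qed.

Lemma monogenic_pair_linear k c u u' : monogenic_pair k u ->
  monogenic_pair k u' -> monogenic_pair k (c *: u + u').
Proof.
case=> [u1 u2 [E1 E2]] [v1 v2 [E1' E2']]; split; rewrite ?rpredD ?rpredZ //.
rewrite /d3_pair /ck_op /= !mderivD !mderivZ E1 E2 E1' E2' !linearP /=.
by congr (_, _); rewrite scalerDr !scalerA mulrC.
Qed.

Lemma monogenic_pair_sum k n :
  (n <= k.*2.+2)%N -> forall c : nat -> K,
  monogenic_pair k (\sum_(j < n) c j *: gt_coord k j).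
Proof.
elim: n => [|n IH] nk c'.
  rewrite big_ord0; split; rewrite /= ?dhomog0 //.
  by rewrite /d3_pair /ck_op [sdzbar _]raddf0 [sdz _]raddf0 !scaler0 !mderiv0.
rewrite big_ord_recr /= addrC; apply: monogenic_pair_linear; last exact: IH (ltnW nk) _.
exact: monogenic_gt.
Qed.

Lemma sdzC g : sdz (sdzbar g) = sdzbar (sdz g).
Proof.
have iC X : 'i *: (2^-1 *: X) = 2^-1 *: ('i *: X) :> G by rewrite !scalerA mulrC.
rewrite /sdz /sdzbar !mderivZ mderivB !mderivD mderivN !mderivZ.
rewrite [d2 (d1 g)]mderiv_comm !iC -scalerBr -scalerDr; congr (_ *: (_ *: _)).
by rewrite scalerDr scalerBr addrKA subrKA.
Qed.

Lemma monogenic_derivative k u (D : G -> G) :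
  (forall c g, D (c *: g) = c *: D g) ->
  (forall g, D (sdz g) = sdz (D g)) -> (forall g, D (sdzbar g) = sdzbar (D g)) ->
  (forall g, d3 (D g) = D (d3 g)) ->
  (forall g, g \is k.+1.-homog -> D g \is k.-homog) ->
  monogenic_pair k.+1 u -> monogenic_pair k (D u.1, D u.2).
Proof.
move=> DZ Dz Db D3 Dh [u1 u2 [E1 E2]]; split; rewrite /= ?Dh //.
by rewrite /d3_pair /ck_op /= !D3 E1 E2 (DZ (sg * 2)) (DZ (- sg * 2)) Dz Db.
Qed.

Lemma d12E g : d1 g = sdz g + sdzbar g /\ 'i *: d2 g = sdzbar g - sdz g.
Proof.
split; rewrite /sdz /sdzbar; first by rewrite -scalerDr addrACA addNr addr0 half_addrr.
by rewrite -scalerBr opprB addrC subrKA half_addrr.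
Qed.

Definition combination k (c : nat -> K) : W :=
  \sum_(j < k.*2.+2) c j *: gt_coord k j.

Lemma dz_combination k (c : nat -> K) :
  dz_pair (combination k.+1 c) = combination k (fun j => c j.+2).
Proof.
have dzZ (x : K) u : dz_pair (x *: u) = x *: dz_pair u by exact: linearZZ.
rewrite /combination linear_sum /= doubleS 2!big_ord_recl !dzZ !dz_gt0 // !scaler0.
by rewrite !add0r; apply: eq_bigr => j _; rewrite dzZ dz_gt.
Qed.

Lemma dzbar_combination k (c : nat -> K) :
  dzbar_pair (combination k.+1 c) = combination k c.
Proof.
have dzZ (x : K) u : dzbar_pair (x *: u) = x *: dzbar_pair u by exact: linearZZ.
rewrite /combination linear_sum /= doubleS 2!big_ord_recr /= !dzZ !dzbar_gt.
rewrite (@gt_out k k.*2.+2) // (@gt_out k k.*2.+3) // !scaler0 !addr0.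
by apply: eq_bigr => j _; rewrite dzZ dzbar_gt.
Qed.

Lemma combination0 (c : nat -> K) : combination 0 c = (c 0%N *: 1, c 1%N *: 1).
Proof.
have s1 : solid 0 1 1 = 1.
  rewrite /solid /harmonic big_ord_recl big_ord0 addr0 /h_term /dpow /=.
  by rewrite invr1 !scale1r !mulr1.
rewrite /combination !big_ord_recl big_ord0 addr0 /gt_coord /gt_pair /= s1.
rewrite !solid0 // !scaler0; congr (_, _) => /=; rewrite ?scaler0 ?addr0 ?add0r //.
Qed.

(** dz reaches the coefficients of index at least 2, dzbar those of index 0
and 1. *)
Lemma combination_free k (c : nat -> K) :
  combination k c = 0 -> forall j, (j < k.*2.+2)%N -> c j = 0.
Proof.
elim: k c => [|k IH] c c0.
  rewrite combination0 in c0.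
  have /eqP : c 0%N *: 1 = 0 :> G by have := congr1 (fun u : W => u.1) c0.
  rewrite scaler_eq0 oner_eq0 orbF => /eqP c00.
  have /eqP : c 1%N *: 1 = 0 :> G by have := congr1 (fun u : W => u.2) c0.
  rewrite scaler_eq0 oner_eq0 orbF => /eqP c01.
  by case=> [|[|j]].
have Hz := IH _ (etrans (esym (dz_combination k c)) (etrans (congr1 _ c0) (raddf0 _))).
have Hb := IH _ (etrans (esym (dzbar_combination k c)) (etrans (congr1 _ c0) (raddf0 _))).
by case=> [|[|j]] jk; [exact: Hb | exact: Hb | exact: Hz].
Qed.

Lemma homog0_const g : g \is 0.-homog -> g = g@_0 *: 1.
Proof.
move=> g0; apply/mpolyP => m; rewrite mcoeffZ mcoeff1.
case: eqP => [->|/eqP m0]; first by rewrite mulr1.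
by rewrite mulr0; apply: (dhomog_nemf_coeff g0); rewrite /= mdeg_eq0.
Qed.

Lemma homog_mderiv_eq0 k g : g \is k.+1.-homog ->
  (forall i, mderiv i g = 0) -> g = 0.
Proof.
move=> gk dg; apply/mpolyP => m; rewrite mcoeff0.
case: (eqVneq (mdeg m) k.+1) => mk; last exact: (dhomog_nemf_coeff gk).
have /existsP[i mi] : [exists i, m i != 0%N].
  apply: contra_eqT mk; rewrite negb_exists => /forallP m0.
  suff -> : m = 0%MM by rewrite mdeg0.
  by apply/mnmP => i; rewrite mnm0E; apply/eqP/negPn; apply: m0.
have Um : (U_(i) <= m)%MM by rewrite lep1mP.
have /eqP := congr1 (mcoeff (m - U_(i))) (dg i).
by rewrite mcoeff_deriv submK // mcoeff0 mulrn_eq0 /= => /eqP.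
Qed.

(** d/dx_3 acts on a monogenic pair as a combination of dz and dzbar, so all the
first derivatives vanish. *)
Lemma monogenic_flat_eq0 k u : monogenic_pair k.+1 u ->
  dz_pair u = 0 -> dzbar_pair u = 0 -> u = 0.
Proof.
case: u => g h [/= gk hk E3] Ez Eb.
have /= g3 := congr1 (fun u : W => u.1) E3.
have /= h3 := congr1 (fun u : W => u.2) E3.
have /= gz := congr1 (fun u : W => u.1) Ez.
have /= hz := congr1 (fun u : W => u.2) Ez.
have /= gb := congr1 (fun u : W => u.1) Eb.
have /= hb := congr1 (fun u : W => u.2) Eb.
have flat p : sdz p = 0 -> sdzbar p = 0 -> d1 p = 0 /\ d2 p = 0.
  move=> pz pb; have [E1 E2] := d12E p; split; first by rewrite E1 pz pb addr0.
  by apply/eqP; have/eqP := E2; rewrite pz pb subrr scaler_eq0 (negPf (neq0Ci _)).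
have const p : p \is k.+1.-homog -> sdz p = 0 -> sdzbar p = 0 -> d3 p = 0 -> p = 0.
  move=> pk pz pb p3; apply: (homog_mderiv_eq0 pk) => i.
  have [p1 p2] := flat p pz pb.
  have [->|[->|->]] // : i = 0 \/ i = 1 \/ i = 2.
  case: i => [[|[|[|//]]] lt]; [left|right; left|right; right]; exact: val_inj.
congr (_, _); first by apply: const => //; rewrite g3 hb scaler0.
by apply: const => //; rewrite h3 gz scaler0.
Qed.

(** Up to the two terms of index 0 and 1, dz only renumbers the basis. *)
Lemma dz_combination_inj k (c : nat -> K) : (forall j, (j < 2)%N -> c j = 0) ->
  dz_pair (combination k c) = 0 -> combination k c = 0.
Proof.
move=> c01; case: k => [|k]; first by rewrite combination0 !c01 ?scale0r.
rewrite dz_combination => /combination_free c2.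
rewrite /combination big1 // => -[[|[|j]] jk] _ /=.
- by rewrite c01 ?scale0r.
- by rewrite c01 ?scale0r.
by rewrite c2 ?scale0r //; move: jk; rewrite doubleS.
Qed.

(** The coefficients are read off dzbar u for the indices 0 and 1 and off dz u,
shifted by 2, for the others.  The error v then satisfies dz v = 0, and its
derivative dzbar v is a combination without terms of index 0 and 1 that dz
kills, because dz and dzbar commute; hence dzbar v = 0 as well. *)
Lemma combination_span k u : monogenic_pair k u ->
  exists c : nat -> K, u = combination k c.
Proof.
elim: k u => [|k IH] u mu.
  case: mu; case: u => g h /= /homog0_const-> /homog0_const-> _.
  by exists (fun j => if j is 0 then g@_0 else h@_0); rewrite combination0.
have mz : monogenic_pair k (dz_pair u).
  apply: (@monogenic_derivative k u sdz) mu => [c||||] g //.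
  - exact: linearZZ.
  - exact: sdzC.
  - by rewrite /sdz mderivZ mderivB mderivZ [d3 (d1 g)]mderiv_comm [d3 (d2 g)]mderiv_comm.
  - by move=> gk; rewrite /sdz rpredZ ?rpredB ?rpredZ ?mderiv_homog.
have mb : monogenic_pair k (dzbar_pair u).
  apply: (@monogenic_derivative k u sdzbar) mu => [c||||] g //.
  - exact: linearZZ.
  - by rewrite sdzC.
  - by rewrite /sdzbar mderivZ mderivD mderivZ [d3 (d1 g)]mderiv_comm [d3 (d2 g)]mderiv_comm.
  - by move=> gk; rewrite /sdzbar rpredZ ?rpredD ?rpredZ ?mderiv_homog.
have [a Ea] := IH _ mz; have [b Eb] := IH _ mb.
pose c j := if j is j'.+2 then a j' else b j.
exists c; pose v := u - combination k.+1 c.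
have vz : dz_pair v = 0 by rewrite raddfB /= Ea dz_combination subrr.
have vb : dzbar_pair v = combination k (fun j => b j - c j).
  rewrite raddfB /= Eb dzbar_combination /combination -sumrB.
  by apply: eq_bigr => j _; rewrite scalerBl.
suff vb0 : dzbar_pair v = 0.
  apply/eqP; rewrite -subr_eq0 -/v; apply/eqP; apply: monogenic_flat_eq0 vz vb0.
  rewrite /v addrC -scaleN1r; apply: monogenic_pair_linear mu.
  exact: monogenic_pair_sum.
have dzC w : dz_pair (dzbar_pair w) = dzbar_pair (dz_pair w).
  by rewrite /dz_pair /dzbar_pair /= !sdzC.
rewrite vb; apply: dz_combination_inj; first by case=> [|[]] //= _; rewrite subrr.
by rewrite -vb dzC vz raddf0.
Qed.

Definition rotation g : G := X1 * d2 g - X2 * d1 g.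

Definition so2_pair u : W :=
  ('i *: u.1 - 2 *: rotation u.1, - 'i *: u.2 - 2 *: rotation u.2).

Lemma rotationZ c g : rotation (c *: g) = c *: rotation g.
Proof. by rewrite /rotation !mderivZ -!scalerAr scalerBr. Qed.

(** c is the eigenvalue of e_1 e_2 on the spinor, to which the rotation of the
variables adds a multiple of a - b. *)
Lemma weight_solid c c' d e a b : c' = c - 2 * ('i * (a%:R - b%:R)) ->
  c *: (d *: solid e a b) - 2 *: rotation (d *: solid e a b) =
  c' *: (d *: solid e a b).
Proof.
move=> ->; rewrite rotationZ /rotation rotation_solid !scalerA -scalerBl mulrBl.
by congr ((_ - _) *: _); ring.
Qed.

Lemma so2_gt k n : (n <= k.*2.+1)%N ->
  so2_pair (gt_coord k n) = ('i * (1 + k.*2%:R - n.*2%:R)) *: gt_coord k n.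
Proof.
move=> nk; have dbl m : m.*2%:R = 2 * m%:R :> K by rewrite -muln2 natrM mulrC.
have := odd_double_half n; rewrite /gt_coord; set j := n./2; rewrite !dbl.
case: (odd n) => En; rewrite /so2_pair /=; congr (_, _).
- apply: weight_solid.
  have -> : n%:R = 2 * j%:R + 1 :> K by rewrite -En -dbl natr1.
  have -> : (k.+1 - j).-1%:R = k%:R - j%:R :> K.
    by rewrite -natrB; [congr _%:R | ]; lia.
  by rewrite -natr1; ring.
- have := @weight_solid (- 'i) ('i * (1 + 2 * k%:R - 2 * n%:R)) 1 0 j.+1 (k.+1 - j).
  rewrite !scale1r; apply; rewrite natrB; last by lia.
  have -> : n%:R = 2 * j%:R + 1 :> K by rewrite -En -dbl natr1.
  by rewrite -!natr1; ring.
- have := @weight_solid 'i ('i * (1 + 2 * k%:R - 2 * n%:R)) 1 0 j.+1 (k.+1 - j).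
  rewrite !scale1r; apply; rewrite natrB; last by lia.
  have -> : n%:R = 2 * j%:R :> K by rewrite -En -dbl.
  by rewrite -!natr1; ring.
- apply: weight_solid; rewrite natrB; last by lia.
  have -> : n%:R = 2 * j%:R :> K by rewrite -En -dbl.
  by rewrite -!natr1; ring.
Qed.

Definition conj_poly : G -> G := map_mpoly Num.conj.

Lemma conj_solid e a b : conj_poly (solid e a b) = solid e b a.
Proof.
have cX i : conj_poly 'X_i = 'X_i by exact: map_mpolyX.
have cZ c g : conj_poly (c *: g) = c^* *: conj_poly g by exact: map_mpolyZ.
have cD g h : conj_poly (g + h) = conj_poly g + conj_poly h by exact: raddfD.
have ci : ('i^* : K) = - 'i := conjCi K.
apply: (@rmorph_harmonic K G (map_mpoly Num.conj) Num.conj) => //.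
- by change (conj_poly (2 *: X3) = 2 *: X3); rewrite cZ cX rmorph_nat.
- by change (conj_poly zpoly = zbarpoly); rewrite /zpoly cD cZ !cX ci scaleNr.
- by change (conj_poly zbarpoly = zpoly); rewrite /zbarpoly -scaleNr cD cZ !cX rmorphN /= ci opprK.
Qed.

Definition star_pair u : W := (- conj_poly u.2, conj_poly u.1).

Lemma star_gt k n : sg^* = sg -> (n <= k.*2.+1)%N ->
  gt_coord k (k.*2.+1 - n) = (-1) ^+ n *: star_pair (gt_coord k n).
Proof.
move=> sgr nk; rewrite -signr_odd; have := odd_double_half n.
have cZ c g : conj_poly (c *: g) = c^* *: conj_poly g by exact: map_mpolyZ.
rewrite /gt_coord (_ : odd (k.*2.+1 - n) = ~~ odd n); last first.
  by rewrite oddB // oddS odd_double addTb.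
case: (odd n) => En.
  have E1 : (k.*2.+1 - n)./2.+1 = (k.+1 - n./2)%N by lia.
  have E2 : (k.+1 - (k.*2.+1 - n)./2)%N = n./2.+1 by lia.
  rewrite E1 E2 /gt_pair /star_pair /= cZ !conj_solid sgr expr1 scaleN1r.
  by congr (_, _); rewrite /= ?opprK // scaleNr.
have E1 : (k.*2.+1 - n)./2.+1 = (k.+1 - n./2)%N by lia.
have E2 : (k.+1 - (k.*2.+1 - n)./2)%N = n./2.+1 by lia.
rewrite E1 E2 /gt_pair /star_pair /= cZ !conj_solid rmorphN /= sgr expr0 scale1r.
by congr (_, _); rewrite /= scaleNr opprK.
Qed.

(** The exponential of x_3 times [ck_op], cut off after n terms. *)
Definition ck_sum n u : W :=
  \sum_(s < n) s`!%:R^-1 *: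
    (X3 ^+ s * (iter s ck_op u).1, X3 ^+ s * (iter s ck_op u).2).

Definition zmon a b : G := dpow zpoly a * dpow zbarpoly b.

Lemma zmon_derivatives a b :
  sdz (zmon a b) = zmon a.-1 b /\ sdzbar (zmon a b) = zmon a b.-1.
Proof.
have D i (x : G) n : mderiv i (dpow x n) = mderiv i x * dpow x n.-1.
  exact: (@derivation_dpow K G (mderiv i) (mderivM i) x n).
have M i (c c' : K) : mderiv i zpoly = c%:A -> mderiv i zbarpoly = c'%:A ->
    mderiv i (zmon a b) = c *: zmon a.-1 b + c' *: zmon a b.-1.
  by move=> zi zbi; rewrite mderivM !D zi zbi -!mulrA !mulr_algl -scalerAr.
have [z1 zb1 z2 zb2] := d12_zpoly.
by apply: wirtinger; rewrite (M _ _ _ z1 zb1, M _ _ _ z2 zb2) ?scale1r ?scaleNr.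
Qed.

Lemma sdzZ c g : sdz (c *: g) = c *: sdz g. Proof. exact: linearZZ. Qed.
Lemma sdzbarZ c g : sdzbar (c *: g) = c *: sdzbar g. Proof. exact: linearZZ. Qed.

Lemma ck_op_even c a b :
  ck_op (c *: zmon a b, 0) = (0, (- sg * 2 * c) *: zmon a.-1 b).
Proof.
rewrite /ck_op /= [sdzbar 0]raddf0 scaler0 sdzZ.
by rewrite (zmon_derivatives a b).1 scalerA.
Qed.

Lemma ck_op_odd c a b :
  ck_op (0, c *: zmon a b) = ((sg * 2 * c) *: zmon a b.-1, 0).
Proof.
rewrite /ck_op /= [sdz 0]raddf0 scaler0 sdzbarZ.
by rewrite (zmon_derivatives a b).2 scalerA.
Qed.

Lemma ck_op2 : sg * 2 * (- sg * 2) = - 4.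
Proof.
rewrite mulrACA mulrN sg_sqr mulN1r; congr (- _).
by rewrite -natrM.
Qed.

Lemma iter_ck_even s a b :
  iter s.*2 ck_op (zmon a b, 0) = ((-4) ^+ s *: zmon (a - s) (b - s), 0).
Proof.
elim: s => [|s IH]; first by rewrite !subn0 scale1r.
rewrite doubleS !iterS IH ck_op_even ck_op_odd mulrA ck_op2 -exprS.
by rewrite !subnS.
Qed.

Lemma iter_ck_odd s a b :
  iter s.*2 ck_op (0, zmon a b) = (0, (-4) ^+ s *: zmon (a - s) (b - s)).
Proof.
elim: s => [|s IH]; first by rewrite !subn0 scale1r.
rewrite doubleS !iterS IH ck_op_odd ck_op_even mulrA [- sg * 2 * _]mulrC ck_op2 -exprS.
by rewrite !subnS.
Qed.

(** The factors 4^s brought in by [ck_op2] are absorbed in the powers of 2 x_3. *)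
Lemma ck_term e s m a b c : m = (2 * s + e)%N -> c = (-1) ^+ s * 2 ^+ m ->
  m`!%:R^-1 *: (X3 ^+ m * (c *: zmon (a - s) (b - s))) =
  h_term (2 *: X3) zpoly zbarpoly e a b s.
Proof.
move=> -> ->; rewrite /h_term /dpow -/(dpow zpoly _) -/(dpow zbarpoly _) exprZn /zmon.
by rewrite -!mulrA -!scalerAr -!scalerAl !scalerA mulrCA.
Qed.

Lemma ck_sumS n u v : iter n ck_op u = v -> ck_sum n.+1 u =
  ck_sum n u + n`!%:R^-1 *: (X3 ^+ n * v.1, X3 ^+ n * v.2).
Proof. by move=> <-; rewrite /ck_sum big_ord_recr. Qed.

Lemma ck_sum_even n a b : (minn a b <= n)%N ->
  ck_sum n.*2 (zmon a b, 0) = gt_pair false a b.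
Proof.
move=> abn; rewrite /gt_pair /solid (harmonic_widen _ _ _ _ abn).
rewrite (@harmonic_widen _ _ _ _ _ 1 a.-1 b n); last by lia.
elim: n {abn} => [|n IH]; first by rewrite /ck_sum !big_ord0 scaler0.
rewrite doubleS (ck_sumS (etrans (iterS _ _ _) (congr1 _ (iter_ck_even _ _ _)))).
rewrite (ck_sumS (iter_ck_even _ _ _)) IH ck_op_even !big_ord_recr /= !mulr0.
have four : (-4) ^+ n = (-1) ^+ n * 2 ^+ n.*2 :> K.
  by rewrite -[-4]mulN1r exprMn -mul2n exprM expr2 -natrM.
rewrite -(@ck_term 0 n n.*2 _ _ ((-4) ^+ n)) // ?addn0 ?mul2n //.
rewrite -(@ck_term 1 n n.*2.+1 _ _ (2 * (-4) ^+ n)) ?addn1 ?mul2n //; last first.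
  by rewrite exprSr mulrA -four mulrC.
have -> : (a.-1 - n = (a - n).-1)%N by lia.
rewrite scalerDr -!scalerAr !scalerA; congr (_, _); rewrite /= ?addr0 ?scaler0 ?addr0.
  by rewrite scalerA.
by rewrite scalerA; congr (_ + _ *: _); ring.
Qed.

Lemma ck_sum_odd n a b : (minn a b <= n)%N ->
  ck_sum n.*2 (0, zmon a b) = gt_pair true a b.
Proof.
move=> abn; rewrite /gt_pair /solid (harmonic_widen _ _ _ _ abn).
rewrite (@harmonic_widen _ _ _ _ _ 1 a b.-1 n); last by lia.
elim: n {abn} => [|n IH]; first by rewrite /ck_sum !big_ord0 scaler0.
rewrite doubleS (ck_sumS (etrans (iterS _ _ _) (congr1 _ (iter_ck_odd _ _ _)))).
rewrite (ck_sumS (iter_ck_odd _ _ _)) IH ck_op_odd !big_ord_recr /= !mulr0.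
have four : (-4) ^+ n = (-1) ^+ n * 2 ^+ n.*2 :> K.
  by rewrite -[-4]mulN1r exprMn -mul2n exprM expr2 -natrM.
rewrite -(@ck_term 0 n n.*2 _ _ ((-4) ^+ n)) // ?addn0 ?mul2n //.
rewrite -(@ck_term 1 n n.*2.+1 _ _ (2 * (-4) ^+ n)) ?addn1 ?mul2n //; last first.
  by rewrite exprSr mulrA -four mulrC.
have -> : (b.-1 - n = (b - n).-1)%N by lia.
rewrite scalerDr -!scalerAr !scalerA; congr (_, _); rewrite /= ?addr0 ?scaler0 ?addr0.
  by rewrite scalerA; congr (_ + _ *: _); ring.
by rewrite scalerA.
Qed.

Lemma ck_opE g h : ck_op (g, h) =
  (sg *: d1 h + ('i * sg) *: d2 h, - sg *: d1 g + ('i * sg) *: d2 g).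
Proof.
rewrite /ck_op /= /sdz /sdzbar !scale_mul2_half.
move: (d1 g) (d2 g) (d1 h) (d2 h) => g1 g2 h1 h2.
congr (_, _); first by rewrite scalerDr scalerA mulrC.
by rewrite scalerBr scalerA mulNr !scaleNr opprK mulrC.
Qed.

Lemma zmonE j l : (j`! * l`!)%N%:R^-1 *: (zpoly ^+ j * zbarpoly ^+ l) = zmon j.+1 l.+1.
Proof. by rewrite /zmon /dpow -scalerAl -scalerAr scalerA natrM invfM. Qed.

Lemma gt_termE e j l s : (s <= j)%N -> (s <= l)%N ->
  ((-1) ^+ s / ((2 * s + e)`! * (j - s)`! * (l - s)`!)%N%:R) *:
    ((2 *: X3) ^+ (2 * s + e) * zpoly ^+ (j - s) * zbarpoly ^+ (l - s)) =
  h_term (2 *: X3) zpoly zbarpoly e j.+1 l.+1 s.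
Proof.
move=> sj sl; rewrite /h_term (subSn sj) (subSn sl) /dpow.
have sM (c d : K) (x y : G) : (c *: x) * (d *: y) = (c * d) *: (x * y).
  by rewrite -scalerAl -scalerAr scalerA.
by rewrite !sM [RHS]scalerA; congr (_ *: _); rewrite !natrM !invfM.
Qed.

Lemma gt_pE j l :
  \sum_(s < (minn j l).+1)
     ((-1) ^+ s / ((2 * s)`! * (j - s)`! * (l - s)`!)%N%:R) *:
     ((2 *: X3) ^+ (2 * s) * zpoly ^+ (j - s) * zbarpoly ^+ (l - s)) =
  solid 0 j.+1 l.+1.
Proof.
rewrite /solid (@harmonic_widen _ _ _ _ _ 0 j.+1 l.+1 (minn j l).+1); last by lia.
apply: eq_bigr => s _; have := ltn_ord s => ls.
by rewrite -gt_termE ?addn0 //; lia.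
Qed.

Lemma gt_qE j l :
  \sum_(s < (minn j l).+1)
     ((-1) ^+ s / ((2 * s).+1`! * (j - s)`! * (l - s)`!)%N%:R) *:
     ((2 *: X3) ^+ (2 * s).+1 * zpoly ^+ (j - s) * zbarpoly ^+ (l - s)) =
  solid 1 j.+1 l.+1.
Proof.
rewrite /solid (@harmonic_widen _ _ _ _ _ 1 j.+1 l.+1 (minn j l).+1); last by lia.
apply: eq_bigr => s _; have := ltn_ord s => ls.
by rewrite -gt_termE ?addn1 //; lia.
Qed.

Lemma gt_even k j :
  gt_coord k (2 * j) = (solid 0 j.+1 (k.+1 - j), - sg *: solid 1 j (k.+1 - j)).
Proof. by rewrite /gt_coord mul2n odd_double doubleK. Qed.

Lemma gt_odd k j :
  gt_coord k (2 * j).+1 = (sg *: solid 1 j.+1 (k - j), solid 0 j.+1 (k.+1 - j)).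
Proof. by rewrite /gt_coord mul2n /= odd_double uphalf_double /gt_pair -subnS subSS. Qed.

End HarmonicPairs.

(** * From pairs to polynomials with coefficients in an algebra *)

(** Besides e3^2 = -1, only the products e_i e_j v and e_i e_j w enter here, so the
coefficients lie in an arbitrary algebra A with two vectors v and w on which the
e_i e_j act as on v^+ and v^-.  The operators named alg_ are those of the statement, with A in
place of the Clifford algebra. *)

Section AlgebraValued.
Variables (K : numClosedFieldType) (A : algType K) (v w : A).
Implicit Types (P Q : {mpoly A[3]}) (g h : {mpoly K[3]}) (c : K) (i : 'I_3).

Definition pair_poly g h : {mpoly A[3]} :=
  v *: map_mpoly (in_alg A) g + w *: map_mpoly (in_alg A) h.

Lemma mcoeff_scaler (x : A) P m : (x *: P)@_m = x * P@_m.
Proof. exact: mcoeffZ. Qed.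

Lemma mcoeff_scale_alg c P m : (c%:A *: P)@_m = c *: P@_m.
Proof. by rewrite mcoeff_scaler mulr_algl. Qed.

Lemma mcoeff_pair g h m : (pair_poly g h)@_m = g@_m *: v + h@_m *: w.
Proof.
rewrite /pair_poly; rewrite -> mcoeffD, !mcoeff_scaler, !mcoeff_map_mpoly.
by rewrite /= !mulr_algr.
Qed.

Lemma pairD g h g' h' :
  pair_poly (g + g') (h + h') = pair_poly g h + pair_poly g' h'.
Proof.
apply/mpolyP => m; rewrite -> mcoeffD, !mcoeff_pair, !mcoeffD, !scalerDl.
exact: addrACA.
Qed.

Lemma pairN g h : pair_poly (- g) (- h) = - pair_poly g h.
Proof.
apply/mpolyP => m; apply: etrans (esym (mcoeffN _ _)); rewrite -> !mcoeff_pair.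
by rewrite !mcoeffN !scaleNr opprD.
Qed.

Lemma pairZ c g h : pair_poly (c *: g) (c *: h) = c%:A *: pair_poly g h.
Proof.
apply/mpolyP => m; rewrite -> mcoeff_scale_alg, !mcoeff_pair, !mcoeffZ.
by rewrite scalerDr !scalerA.
Qed.

Lemma mderiv_pair i g h :
  mderiv i (pair_poly g h) = pair_poly (mderiv i g) (mderiv i h).
Proof.
apply/mpolyP => m; rewrite -> mcoeff_deriv, !mcoeff_pair, !mcoeff_deriv.
by rewrite mulrnDl !scalerMnl.
Qed.

Lemma mulX_pair i g h : 'X_i * pair_poly g h = pair_poly ('X_i * g) ('X_i * h).
Proof.
have CX Q : 'X_i * Q = Q * 'X_i by exact: esym (commr_mpolyX _ Q).
have ZX (x : A) P : x *: ('X_i * P) = 'X_i * (x *: P).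
  by rewrite -> !CX; exact: scalerAl.
have mapX g' : map_mpoly (in_alg A) ('X_i * g') = 'X_i * map_mpoly (in_alg A) g'.
  by apply: etrans (rmorphM _ _ _) _; congr (_ * _); apply: map_mpolyX.
by rewrite /pair_poly; rewrite -> !mapX, !ZX; exact: mulrDr.
Qed.

Lemma scale_pair_swap (x y : A) (a b : K) g h :
  x * (y * v) = a *: w -> x * (y * w) = b *: v ->
  x *: (y *: pair_poly g h) = pair_poly (b *: h) (a *: g).
Proof.
move=> xv xw; apply/mpolyP => m.
rewrite -> !mcoeff_scaler, !mcoeff_pair, !mcoeffZ.
rewrite !mulrDr -!scalerAr xv xw !scalerA addrC.
by rewrite [b * _]mulrC [a * _]mulrC.
Qed.

Lemma scale_pair_diag (x y : A) (a b : K) g h :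
  x * (y * v) = a *: v -> x * (y * w) = b *: w ->
  x *: (y *: pair_poly g h) = pair_poly (a *: g) (b *: h).
Proof.
move=> xv xw; apply/mpolyP => m.
rewrite -> !mcoeff_scaler, !mcoeff_pair, !mcoeffZ.
rewrite !mulrDr -!scalerAr xv xw !scalerA.
by rewrite [b * _]mulrC [a * _]mulrC.
Qed.

Lemma pair0 : pair_poly 0 0 = 0.
Proof.
by apply/mpolyP => m; rewrite -> mcoeff_pair, !mcoeff0; rewrite !scale0r addr0.
Qed.

Lemma pair_sum n (c : nat -> K) (f : nat -> {mpoly K[3]} * {mpoly K[3]}) :
  pair_poly (\sum_(j < n) c j *: f j).1 (\sum_(j < n) c j *: f j).2 =
  \sum_(j < n) (c j)%:A *: pair_poly (f j).1 (f j).2.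
Proof.
elim: n => [|n IH]; first by rewrite !big_ord0 pair0.
rewrite !big_ord_recr; exact: etrans (pairD _ _ _ _) (congr2 +%R IH (pairZ _ _ _)).
Qed.

Hypothesis free_vw : forall a b : K, a *: v + b *: w = 0 -> a = 0 /\ b = 0.

Lemma pair_inj g h : pair_poly g h = 0 -> g = 0 /\ h = 0.
Proof.
move=> gh0; suff E m : g@_m = 0 /\ h@_m = 0.
  by split; apply/mpolyP => m; case: (E m); rewrite mcoeff0.
by apply: free_vw; rewrite -mcoeff_pair gh0 mcoeff0.
Qed.

Lemma pair_homog k g h : g \is k.-homog -> h \is k.-homog ->
  pair_poly g h \is k.-homog.
Proof.
move=> gk hk; apply/dhomogP => m; rewrite mcoeff_msupp => nz; apply/eqP.
apply: contraNT nz => mk; apply/eqP; rewrite -> mcoeff_pair.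
by rewrite (dhomog_nemf_coeff gk mk) (dhomog_nemf_coeff hk mk) !scale0r addr0.
Qed.

Definition alg_dz P : {mpoly A[3]} :=
  (2^-1 : K)%:A *: (mderiv (0 : 'I_3) P - ('i : K)%:A *: mderiv (1 : 'I_3) P).

Definition alg_dzbar P : {mpoly A[3]} :=
  (2^-1 : K)%:A *: (mderiv (0 : 'I_3) P + ('i : K)%:A *: mderiv (1 : 'I_3) P).

Lemma alg_dz_pair g h : alg_dz (pair_poly g h) = pair_poly (sdz g) (sdz h).
Proof.
rewrite /alg_dz; rewrite -> !mderiv_pair.
rewrite <- !pairZ, <- pairN, <- pairD, <- pairZ; reflexivity.
Qed.

Lemma alg_dzbar_pair g h :
  alg_dzbar (pair_poly g h) = pair_poly (sdzbar g) (sdzbar h).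
Proof.
rewrite /alg_dzbar; rewrite -> !mderiv_pair.
rewrite <- !pairZ, <- pairD, <- pairZ; reflexivity.
Qed.

Variables (e1 e2 e3 : A) (sg : K).
Hypothesis (e33 : e3 * e3 = -1).
Hypotheses (e31v : e3 * (e1 * v) = - sg *: w) (e31w : e3 * (e1 * w) = sg *: v).
Hypotheses (e32v : e3 * (e2 * v) = ('i * sg) *: w).
Hypotheses (e32w : e3 * (e2 * w) = ('i * sg) *: v).
Hypotheses (e12v : e1 * (e2 * v) = 'i *: v) (e12w : e1 * (e2 * w) = - 'i *: w).

Definition alg_dirac2 P : {mpoly A[3]} :=
  e1 *: mderiv (0 : 'I_3) P + e2 *: mderiv (1 : 'I_3) P.

Definition alg_ck_exp P : {mpoly A[3]} :=
  \sum_(s < msize P)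
     (s`!%:R^-1 : K)%:A *: ('X_(2 : 'I_3) ^+ s
                            * iter s (fun Q => e3 *: alg_dirac2 Q) P).

Definition alg_so2_act P : {mpoly A[3]} :=
  (e1 * e2) *: P
  - 2 *: ('X_(0 : 'I_3) * mderiv (1 : 'I_3) P
          - 'X_(1 : 'I_3) * mderiv (0 : 'I_3) P).

Lemma e3_dirac2_pair g h : e3 *: alg_dirac2 (pair_poly g h) =
  pair_poly (ck_op sg (g, h)).1 (ck_op sg (g, h)).2.
Proof.
rewrite /alg_dirac2; rewrite -> !mderiv_pair, scalerDr.
rewrite -> (scale_pair_swap _ _ e31v e31w), (scale_pair_swap _ _ e32v e32w).
by rewrite <- pairD; rewrite ck_opE.
Qed.

Lemma alg_so2_pair g h (u := so2_pair (g, h)) :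
  alg_so2_act (pair_poly g h) = pair_poly u.1 u.2.
Proof.
have two : (2 : A) = (2 : K)%:A by rewrite scaler_nat.
rewrite /alg_so2_act two; rewrite <- scalerA.
rewrite -> (scale_pair_diag _ _ e12v e12w), !mderiv_pair, !mulX_pair.
rewrite <- pairN, <- pairD, <- pairZ, <- pairN, <- pairD; reflexivity.
Qed.

(** Multiplication by e3 is injective and turns dirac2 + e3 d/dx_3 into
e3 dirac2 - d/dx_3. *)
Lemma dirac3_pair g h :
  alg_dirac2 (pair_poly g h) + e3 *: mderiv (2 : 'I_3) (pair_poly g h) = 0 <->
  d3_pair (g, h) = ck_op sg (g, h).
Proof.
have e33P Q : e3 *: (e3 *: Q) = - Q.
  by apply: etrans (scalerA _ _ _) _; rewrite e33; exact: scaleN1r.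
have e3E Q : e3 *: (Q + e3 *: mderiv (2 : 'I_3) (pair_poly g h)) =
    e3 *: Q - pair_poly (mderiv (2 : 'I_3) g) (mderiv (2 : 'I_3) h).
  apply: etrans (scalerDr _ _ _) _; congr (_ + _); rewrite -> e33P, mderiv_pair.
  reflexivity.
split=> [D0|E]; last first.
  set X := (X in X = 0); have: e3 *: X = 0.
    rewrite /X e3E; apply/eqP; rewrite subr_eq0; apply/eqP.
    by rewrite -> e3_dirac2_pair; rewrite -E.
  move=> X0; have := e33P X; rewrite X0 => /esym/eqP.
  by rewrite scaler0 oppr_eq0 => /eqP.
have: e3 *: alg_dirac2 (pair_poly g h) -
      pair_poly (mderiv (2 : 'I_3) g) (mderiv (2 : 'I_3) h) = 0.
  by rewrite -e3E D0 scaler0.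
rewrite -> e3_dirac2_pair; rewrite <- pairN, <- pairD => /pair_inj.
case: (ck_op sg (g, h)) => p q /= [/eqP + /eqP]; rewrite !subr_eq0.
by rewrite /d3_pair /= => /eqP-> /eqP->.
Qed.

Lemma iter_dirac2_pair s g h :
  iter s (fun Q => e3 *: alg_dirac2 Q) (pair_poly g h) =
  pair_poly (iter s (ck_op sg) (g, h)).1 (iter s (ck_op sg) (g, h)).2.
Proof.
elim: s => [|s IH]; first by [].
apply: etrans (iterS _ _ _) _; rewrite -> IH, iterS.
by case: (iter s _ _) => p q; exact: e3_dirac2_pair.
Qed.

Lemma mulXn_pair i n g h :
  'X_i ^+ n * pair_poly g h = pair_poly ('X_i ^+ n * g) ('X_i ^+ n * h).
Proof.
elim: n => [|n IH]; first by rewrite -> !expr0, !mul1r.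
by rewrite -> !exprS; rewrite <- !mulrA; rewrite -> IH; exact: mulX_pair.
Qed.

Lemma mcoeff_dirac2 P m : (alg_dirac2 P)@_m =
  e1 * (P@_(m + U_(0)) *+ (m 0).+1) + e2 * (P@_(m + U_(1)) *+ (m 1).+1).
Proof.
rewrite /alg_dirac2; rewrite -> mcoeffD, !mcoeff_scaler, !mcoeff_deriv; reflexivity.
Qed.

(** Each application of dirac2 lowers the degree. *)
Lemma iter_vanish s P m : (msize P <= mdeg m + s)%N ->
  (iter s (fun Q => e3 *: alg_dirac2 Q) P)@_m = 0.
Proof.
elim: s m => [|s IH] m le /=.
  by apply/eqP; rewrite mcoeff_eq0; apply: msize_mdeg_ge; rewrite addn0 in le.
rewrite -> mcoeff_scaler, mcoeff_dirac2, !IH.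
- by rewrite !mul0rn !mulr0 addr0 mulr0.
- by rewrite mdegD mdeg1; lia.
- by rewrite mdegD mdeg1; lia.
Qed.

(** The number of terms in the exponential depends on the degree of P; the bound
can be raised because the further terms vanish. *)
Lemma alg_ck_exp_widen n P : (msize P <= n)%N -> alg_ck_exp P =
  \sum_(s < n) (s`!%:R^-1 : K)%:A *: ('X_(2 : 'I_3) ^+ s
                            * iter s (fun Q => e3 *: alg_dirac2 Q) P).
Proof.
move=> le; pose F s : {mpoly A[3]} := (s`!%:R^-1 : K)%:A *: ('X_(2 : 'I_3) ^+ s
                            * iter s (fun Q => e3 *: alg_dirac2 Q) P).
rewrite /alg_ck_exp (big_ord_widen n F le) big_mkcond /=.
apply: eq_bigr => s _; case: ltnP => // sP.
have -> : iter s (fun Q => e3 *: alg_dirac2 Q) P = 0.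
  by apply/mpolyP => m; rewrite iter_vanish ?mcoeff0 //; apply: leq_trans sP (leq_addl _ _).
by rewrite mulr0 scaler0.
Qed.

Lemma alg_ck_exp_pair g h : exists n0, forall n, (n0 <= n)%N ->
  alg_ck_exp (pair_poly g h) =
  pair_poly (ck_sum sg n (g, h)).1 (ck_sum sg n (g, h)).2.
Proof.
exists (msize (pair_poly g h)) => n le; rewrite (alg_ck_exp_widen le) /ck_sum.
rewrite (pair_sum n (fun s => s`!%:R^-1) (fun s =>
  ('X_(2 : 'I_3) ^+ s * (iter s (ck_op sg) (g, h)).1,
   'X_(2 : 'I_3) ^+ s * (iter s (ck_op sg) (g, h)).2))).
apply: eq_bigr => s _; congr (_ *: _) => /=.
apply: etrans (congr1 _ (iter_dirac2_pair _ _ _)) _; exact: mulXn_pair.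
Qed.

Hypothesis sg_sqr : sg * sg = 1.

Definition alg_monogenic k P : Prop :=
  [/\ P \is k.-homog, forall m, exists a b : K, P@_m = a *: v + b *: w &
      alg_dirac2 P + e3 *: mderiv (2 : 'I_3) P = 0].

Lemma alg_monogenic_pair k g h :
  monogenic_pair sg k (g, h) -> alg_monogenic k (pair_poly g h).
Proof.
case=> /= gk hk E; split; first exact: pair_homog.
  by move=> m; exists g@_m, h@_m; rewrite -> mcoeff_pair.
exact/dirac3_pair.
Qed.

Variables cv cw : {additive A -> K}.
Hypothesis cvw : forall a b : K, cv (a *: v + b *: w) = a /\ cw (a *: v + b *: w) = b.

(** The coordinate functionals, applied to each coefficient of P, recover g
and h. *)
Lemma alg_monogenicP k P : alg_monogenic k P ->
  exists2 u, P = pair_poly u.1 u.2 & monogenic_pair sg k u.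
Proof.
case=> Pk Pvw PD; pose g := map_mpoly cv P; pose h := map_mpoly cw P.
have PE : P = pair_poly g h.
  apply/mpolyP => m; rewrite -> mcoeff_pair; rewrite /g /h; rewrite -> !mcoeff_map_mpoly.
  by have [a [b E]] := Pvw m; have [c1 c2] := cvw a b; rewrite E c1 c2.
have chomog (c : {additive A -> K}) : map_mpoly c P \is k.-homog.
  apply/dhomogP => m; rewrite mcoeff_msupp mcoeff_map_mpoly => nz; apply/eqP.
  by apply: contraNT nz => mk; rewrite (dhomog_nemf_coeff Pk mk) raddf0.
exists (g, h) => //; split=> //=; try exact: chomog.
by apply/dirac3_pair; rewrite -PE.
Qed.

Lemma alg_basis k P : alg_monogenic k P ->
  exists! c : {ffun 'I_(k.*2.+2) -> K},
    P = \sum_(j < k.*2.+2) (c j)%:A *: pair_poly (gt_coord sg k j).1 (gt_coord sg k j).2.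
Proof.
have combE (c : {ffun 'I_(k.*2.+2) -> K}) (d := fun j => c (inord j))
    (u := combination sg k d) :
    \sum_(j < k.*2.+2) (c j)%:A *: pair_poly (gt_coord sg k j).1 (gt_coord sg k j).2 =
    pair_poly u.1 u.2.
  apply: etrans (esym (pair_sum _ _ _)); apply: eq_bigr => j _.
  by rewrite /d inord_val.
move=> /alg_monogenicP[u PE /(combination_span sg_sqr)[c uE]].
exists [ffun j : 'I_(k.*2.+2) => c j]; split.
  subst u; rewrite PE.
  suff <- : combination sg k (fun j => [ffun l : 'I_(k.*2.+2) => c l] (inord j)) =
           combination sg k c by exact: esym (combE _).
  by apply: eq_bigr => j _; rewrite ffunE inordK.
move=> c' PE'; apply/ffunP => j; rewrite ffunE.
have /combination_free H : combination sg k (fun j => c j - c' (inord j)) = 0.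
  rewrite /combination; under eq_bigr => l _ do rewrite scalerBl.
  rewrite sumrB; set s1 := (X in X - _); set s2 := (X in _ - X).
  have : pair_poly (s1.1 - s2.1) (s1.2 - s2.2) = 0.
    rewrite -> pairD, pairN; rewrite -(combE c') -PE' PE; subst u; exact: subrr.
  by case/pair_inj => E1 E2; apply/eqP; rewrite -pair_eqE /= E1 E2 !eqxx.
have := H j (ltn_ord j); rewrite inord_val => /eqP.
by rewrite subr_eq0 => /eqP.
Qed.

Variable st : {additive A -> A}.
Hypothesis stE : forall a b : K, st (a *: v + b *: w) = - b^* *: v + a^* *: w.

Lemma alg_star_pair u :
  map_mpoly st (pair_poly u.1 u.2) = pair_poly (star_pair u).1 (star_pair u).2.
Proof.
apply/mpolyP => m; rewrite -> mcoeff_map_mpoly, !mcoeff_pair, stE.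
rewrite /star_pair /conj_poly /= mcoeffN.
by rewrite -> !mcoeff_map_mpoly.
Qed.

Lemma alg_ck_exp_mon (o : bool) a b :
  alg_ck_exp ((if o then w else v) *: map_mpoly (in_alg A) (zmon K a b)) =
  pair_poly (gt_pair sg o a b).1 (gt_pair sg o a b).2.
Proof.
have map0 : map_mpoly (in_alg A) (0 : {mpoly K[3]}) = 0 by exact: raddf0.
have ckE u n0 : (forall n, (n0 <= n)%N -> alg_ck_exp (pair_poly u.1 u.2) =
    pair_poly (ck_sum sg n u).1 (ck_sum sg n u).2) ->
    (forall n, (minn a b <= n)%N -> ck_sum sg n.*2 u = gt_pair sg o a b) ->
    alg_ck_exp (pair_poly u.1 u.2) = pair_poly (gt_pair sg o a b).1 (gt_pair sg o a b).2.
  move=> H1 H2; rewrite (H1 (maxn n0 (minn a b)).*2); last by lia.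
  by rewrite H2 //; lia.
case: o ckE => ckE.
  have [n0 H] := alg_ck_exp_pair 0 (zmon K a b).
  rewrite -(ckE (0, zmon K a b) n0 H (fun n => @ck_sum_odd K sg sg_sqr n a b)).
  by rewrite /pair_poly /= map0 scaler0 add0r.
have [n0 H] := alg_ck_exp_pair (zmon K a b) 0.
rewrite -(ckE (zmon K a b, 0) n0 H (fun n => @ck_sum_even K sg sg_sqr n a b)).
by rewrite /pair_poly /= map0 scaler0 addr0.
Qed.

Lemma alg_gt k n (j := n./2) : (n <= k.*2.+1)%N ->
  alg_ck_exp ((if odd n then w else v) *: map_mpoly (in_alg A)
    ((j`! * (k - j)`!)%N%:R^-1 *: (zpoly K ^+ j * zbarpoly K ^+ (k - j)))) =
  pair_poly (gt_coord sg k n).1 (gt_coord sg k n).2.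
Proof.
move=> nk; have E : (k.+1 - j = (k - j).+1)%N by rewrite subSn // /j; lia.
rewrite /gt_coord E; apply: etrans (alg_ck_exp_mon _ _ _).
by congr (alg_ck_exp (_ *: map_mpoly _ _)); exact: zmonE.
Qed.

End AlgebraValued.

(** * The spinor spaces and the Gelfand-Tsetlin basis *)

Section TwoVectors.
Variables (K : numClosedFieldType) (V : vectType K) (x y : V).
Hypothesis indep : forall a b : K, a *: x + b *: y = 0 -> a = 0 /\ b = 0.
Let X : 2.-tuple V := [tuple x; y].

Lemma free2 : free X.
Proof.
apply/freeP => k; rewrite !big_ord_recl big_ord0 addr0 => E.
have [k0 k1] := indep E.
by case=> [[|[|//]] i]; [rewrite -k0 | rewrite -k1]; congr k; apply: val_inj.
Qed.

Lemma coord2 a b : coord X 0 (a *: x + b *: y) = a /\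
  coord X 1 (a *: x + b *: y) = b.
Proof.
have -> : a *: x + b *: y = \sum_(i < 2) (if val i == 0%N then a else b) *: X`_i.
  by rewrite !big_ord_recl big_ord0 addr0.
by rewrite !coord_sum_free ?free2.
Qed.

Lemma span2P u : u \in <<X>>%VS <-> exists a b : K, u = a *: x + b *: y.
Proof.
split=> [uX|[a [b ->]]]; last first.
  by rewrite memvD ?memvZ ?memv_span // !inE eqxx ?orbT.
exists (coord X 0 u), (coord X 1 u); rewrite {1}(coord_span uX).
by rewrite !big_ord_recl big_ord0 addr0; congr (_ + coord _ _ _ *: _); apply: val_inj.
Qed.

Definition star2 (u : V) : V := - (coord X 1 u)^* *: x + (coord X 0 u)^* *: y.

Lemma star2_is_additive : additive star2.
Proof.
move=> u u'; have cB i : coord X i (u - u') = coord X i u - coord X i u' :> K.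
  exact: raddfB.
rewrite /star2 !cB; move: (coord X 0 u) (coord X 1 u) (coord X 0 u') (coord X 1 u').
move=> a b a' b'; rewrite [in RHS]opprD addrACA -!scalerBl.
by congr (_ *: _ + _ *: _); rewrite rmorphB //= opprD.
Qed.
HB.instance Definition _ := GRing.isAdditive.Build V V star2 star2_is_additive.

(** Packaged as additive maps, the form in which [alg_basis] and
[alg_star_pair] take them. *)
Definition star2_additive : {additive V -> V} := star2.
Definition coord0_additive : {additive V -> K} := coord X 0.
Definition coord1_additive : {additive V -> K} := coord X 1.

End TwoVectors.

Section Spinors.
Variables (R : realType) (S : spin_sign).
Local Notation K := (R[i]).
Local Notation Cl := (Cl4 R).
Local Notation v := (vplus R S).
Local Notation w := (vminus R S).
Local Notation sg := (pm R S).
Implicit Types (g h : scpoly R).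

Lemma gt_f_pair k n : (n <= k.*2.+1)%N ->
  gt_f R S k n = spinor S (gt_coord sg k n).1 (gt_coord sg k n).2.
Proof.
move=> nk; have [p1 p2 p3 p4] := vplus_action R S; have [m1 m2] := vminus_action R S.
exact: (alg_gt p1 m1 p2 m2 (pm_sqr R S) nk).
Qed.

Lemma dz_spinor g h : dz (spinor S g h) = spinor S (sdz g) (sdz h).
Proof. exact: alg_dz_pair. Qed.

Lemma dzbar_spinor g h : dzbar (spinor S g h) = spinor S (sdzbar g) (sdzbar h).
Proof. exact: alg_dzbar_pair. Qed.

Lemma d3_spinor g h (u := d3_pair (g, h)) : d3 (spinor S g h) = spinor S u.1 u.2.
Proof. exact: mderiv_pair. Qed.

Lemma so2_act_spinor g h (u := so2_pair (g, h)) :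
  so2_act (spinor S g h) = spinor S u.1 u.2.
Proof.
have [p1 p2 p3 p4] := vplus_action R S.
exact: (alg_so2_pair p3 p4).
Qed.

Lemma spinorZ (c : K) g h : spinor S (c *: g) (c *: h) = c%:A *: spinor S g h.
Proof. exact: pairZ. Qed.

Lemma spinor00 : @spinor R S 0 0 = 0.
Proof. exact: pair0. Qed.

Lemma coord_spinor (a b : K) :
  coord (spinor_basis R S) 0 (a *: v + b *: w) = a /\
  coord (spinor_basis R S) 1 (a *: v + b *: w) = b.
Proof. exact: (coord2 (@spinor_free R S)). Qed.

Lemma spinor_spaceP (x : Cl) :
  x \in spinor_space R S <-> exists a b : K, x = a *: v + b *: w.
Proof. exact: span2P. Qed.

Lemma spinor_starE (a b : K) :
  spinor_star S (a *: v + b *: w) = - b^* *: v + a^* *: w.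
Proof. by have [c0 c1] := coord_spinor a b; rewrite /spinor_star c0 c1. Qed.

End Spinors.

Lemma alg_sign (F : fieldType) (A : algType F) n :
  ((-1) ^+ n : F)%:A = (-1) ^+ n :> A.
Proof. by rewrite -[LHS]/(in_alg A _) rmorphXn rmorphN1. Qed.

Section GelfandTsetlin.
Variables (R : realType) (S : spin_sign).
Local Notation K := (R[i]).
Local Notation Cl := (Cl4 R).
Local Notation v := (vplus R S).
Local Notation w := (vminus R S).
Local Notation sg := (pm R S).

Lemma monogenicE k (P : clpoly R) : monogenic S k P <->
  alg_monogenic v w (e1 R) (e2 R) (e3 R) k P.
Proof.
split=> -[Pk PS PD]; split=> // m.
  exact: (spinor_spaceP S _).1 (PS m).
exact: (spinor_spaceP S _).2 (PS m).
Qed.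

Lemma gt_f_monogenic k n : (n <= k.*2.+1)%N -> monogenic S k (gt_f R S k n).
Proof.
move=> nk; rewrite (gt_f_pair R S nk); apply/monogenicE.
have [p1 p2 p3 p4] := vplus_action R S; have [m1 m2] := vminus_action R S.
apply: (alg_monogenic_pair (@spinor_free R S) (e_sqr R 2) p1 m1 p2 m2).
move: (monogenic_gt (pm_sqr R S) nk).
by case: (gt_coord _ _ _).
Qed.

Lemma gt_f_sum k (c : {ffun 'I_(k.*2.+2) -> K}) :
  \sum_(j < k.*2.+2) (c j)%:A *: gt_f R S k j =
  \sum_(j < k.*2.+2) (c j)%:A *: pair_poly v w (gt_coord sg k j).1 (gt_coord sg k j).2.
Proof.
by apply: eq_bigr => j _; congr (_ *: _); apply: gt_f_pair; rewrite -ltnS.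
Qed.

Lemma gt_f_spanning k P : monogenic S k P ->
  exists! c : {ffun 'I_(k.*2.+2) -> K},
    P = \sum_(j < k.*2.+2) (c j)%:A *: gt_f R S k j.
Proof.
have [p1 p2 p3 p4] := vplus_action R S; have [m1 m2] := vminus_action R S.
have fr := @spinor_free R S; have cvw := @coord_spinor R S.
move=> /monogenicE mP.
have B := @alg_basis K Cl v w fr (e1 R) (e2 R) (e3 R) sg (e_sqr R 2) p1 m1 p2 m2
    (pm_sqr R S) (coord0_additive v w) (coord1_additive v w) cvw k P mP.
have [c [Pc uc]] := B; exists c; split; first by rewrite gt_f_sum.
by move=> c'; rewrite gt_f_sum; apply: uc.
Qed.

Lemma so2_gt_f k n : (n <= k.*2.+1)%N -> so2_act (gt_f R S k n) =
  ('i * (1 + k.*2%:R - n.*2%:R))%:A *: gt_f R S k n.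
Proof.
move=> nk; rewrite (gt_f_pair R S nk) so2_act_spinor -surjective_pairing.
by rewrite so2_gt // spinorZ.
Qed.

Lemma weight_inj k : injective (fun n : 'I_(k.*2.+2) =>
  'i * (1 + k.*2%:R - n.*2%:R) : K).
Proof.
move=> m n /(mulfI (neq0Ci _)) /addrI /oppr_inj /eqP.
by rewrite eqr_nat => /eqP/double_inj/val_inj.
Qed.

Lemma gt_f_basis k : gelfand_tsetlin_basis S k (gt_f R S k).
Proof.
split; [exact: gt_f_monogenic | exact: gt_f_spanning |].
exists (fun n : 'I_(k.*2.+2) => 'i * (1 + k.*2%:R - n.*2%:R)); first exact: weight_inj.
by move=> n; apply: so2_gt_f; rewrite -ltnS.
Qed.

Lemma gt_p_solid k j : (j <= k)%N -> gt_p R k j = solid K 0 j.+1 (k.+1 - j).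
Proof. by move=> jk; rewrite subSn //; exact: gt_pE. Qed.

Lemma gt_q_solid k j : (j <= k.+1)%N -> gt_q R k j = solid K 1 j (k.+1 - j).
Proof.
move=> jk; rewrite /gt_q; case: ltnP => [j0|]; last first.
  by rewrite leqn0 => /eqP->; rewrite solid0.
case: leqP => [jk'|kj]; last first.
  by rewrite solid0 // orbC (_ : k.+1 - j = 0)%N //; lia.
case: j j0 jk jk' => // j _ _ jk; rewrite subn1 /= subSn //; exact: gt_qE.
Qed.

Lemma gt_f_components k j : (j <= k)%N ->
  gt_f R S k (2 * j) = spinor S (gt_p R k j) (- sg *: gt_q R k j) /\
  gt_f R S k (2 * j).+1 = spinor S (sg *: gt_q R k j.+1) (gt_p R k j).
Proof.
move=> jk; rewrite gt_p_solid // !gt_q_solid //; last exact: leqW.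
rewrite !(gt_f_pair R S); [|lia|lia].
by rewrite gt_even gt_odd subSS.
Qed.

Lemma gt_f_derivatives k j : (0 < k)%N -> (j <= (2 * k).+1)%N ->
  [/\ d3 (gt_f R S k j) =
         (if (1 <= j <= 2 * k)%N
          then (- sg * (-1) ^+ j * 2)%:A *: gt_f R S k.-1 j.-1 else 0),
       dz (gt_f R S k j) =
         (if (2 <= j)%N then gt_f R S k.-1 (j - 2) else 0) &
       dzbar (gt_f R S k j) =
         (if (j <= (2 * k).-1)%N then gt_f R S k.-1 j else 0)].
Proof.
case: k => // k _; rewrite [k.+1.-1]/= mul2n doubleS => jk.
have z0 : spinor S (0 : scpoly R * scpoly R).1 (0 : scpoly R * scpoly R).2 = 0.
  exact: spinor00.
rewrite (@gt_f_pair R S k.+1 j jk); split.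
- rewrite d3_spinor -surjective_pairing.
  case: j jk => [|j] jk; first by rewrite (d3_gt0 (pm_sqr R S)); exact: z0.
  rewrite (d3_gt (pm_sqr R S)) ltn0Sn andTb.
  apply: etrans (spinorZ S _ _ _) _; case: ifP => jk'.
    by apply: congr1; exact: esym (gt_f_pair R S jk').
  rewrite gt_out; last by move/negbT: jk'; rewrite -ltnNge.
  apply: etrans (congr1 _ z0) _; exact: scaler0.
- rewrite dz_spinor; case: j jk => [|[|j]] jk.
  + exact: etrans (congr1 (fun u => spinor S u.1 u.2) (@dz_gt0 _ sg k.+1 0 isT)) z0.
  + exact: etrans (congr1 (fun u => spinor S u.1 u.2) (@dz_gt0 _ sg k.+1 1 isT)) z0.
  + apply: etrans (congr1 (fun u => spinor S u.1 u.2) (dz_gt sg k j)) _.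
    by rewrite subn2; apply: esym (gt_f_pair R S _).
- rewrite dzbar_spinor [k.*2.+2.-1]/=.
  apply: etrans (congr1 (fun u => spinor S u.1 u.2) (dzbar_gt sg k j)) _.
  case: ifP => jk'; first exact: esym (gt_f_pair R S jk').
  by rewrite gt_out; [exact: z0 | move/negbT: jk'; rewrite -ltnNge].
Qed.

Lemma gt_f_star k j : (j <= (2 * k).+1)%N ->
  gt_f R S k ((2 * k).+1 - j) = (-1) ^+ j *: poly_star S (gt_f R S k j).
Proof.
rewrite mul2n => jk; have sgr : (sg)^* = sg.
  by rewrite /pm; case: (S); rewrite ?rmorphN rmorph1.
have -> : poly_star S (gt_f R S k j) =
    spinor S (star_pair (gt_coord sg k j)).1 (star_pair (gt_coord sg k j)).2.
  rewrite gt_f_pair //.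
  exact: (@alg_star_pair K Cl v w (star2_additive v w) (@spinor_starE R S)).
rewrite gt_f_pair ?leq_subr // (star_gt sgr jk).
apply: etrans (spinorZ S _ _ _) _; congr (_ *: _); exact: alg_sign.
Qed.

End GelfandTsetlin.

Theorem corollary3 (R : realType) (S : spin_sign) :
  (forall k : nat, gelfand_tsetlin_basis S k (gt_f R S k)) /\
  (* (a) *)
  (forall k j : nat, (j <= k)%N ->
     gt_f R S k (2 * j) = spinor S (gt_p R k j) (- pm R S *: gt_q R k j) /\
     gt_f R S k (2 * j).+1 = spinor S (pm R S *: gt_q R k j.+1) (gt_p R k j)) /\
  (* (b) *)
  (forall k j : nat, (0 < k)%N -> (j <= (2 * k).+1)%N ->
     [/\ d3 (gt_f R S k j) =
           (if (1 <= j <= 2 * k)%N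
            then (- pm R S * (-1) ^+ j * 2)%:A *: gt_f R S k.-1 j.-1 else 0),
         dz (gt_f R S k j) =
           (if (2 <= j)%N then gt_f R S k.-1 (j - 2) else 0) &
         dzbar (gt_f R S k j) =
           (if (j <= (2 * k).-1)%N then gt_f R S k.-1 j else 0)]) /\
  (* (c) *)
  (forall k j : nat, (j <= (2 * k).+1)%N ->
     gt_f R S k ((2 * k).+1 - j) = (-1) ^+ j *: poly_star S (gt_f R S k j)).
Proof.
split; first exact: gt_f_basis.
split; first exact: gt_f_components.
split; [exact: gt_f_derivatives | exact: gt_f_star].
Qed.
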